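(* Let $K\subset S^3$ be a knot. If $n(K)=n$, then there exists a symmetric $n\times n$ matrix $A$ over $\mathbb{Z}$ which has the following three properties: (1) $|\det(A)|=|\det(K)|$, (2) $l(A)\cong 2\,l(K)$, (3) $A$ modulo two equals the identity matrix. If $\sigma(K)=2n\cdot\epsilon$ with $\epsilon\in\{-1,1\}$, then we can furthermore arrange that $A$ has the following two properties: (4) $A$ is $\epsilon$-definite, (5) the diagonal entries of $A$ modulo four are equal to $-\epsilon$.
   Context: Write $\Lambda=\mathbb{Z}[t^{\pm1}]$, $\Omega=\mathbb{Q}(t)$, with involution $\overline{\cdot}$, $t\mapsto t^{-1}$; $A$ is hermitian if $\overline{A}^t=A$. For a hermitian $n\times n$ matrix $A$ over $\Lambda$ with $\det A\ne0$, $\lambda(A)$ is the pairing $\Lambda^n/A\Lambda^n\times\Lambda^n/A\Lambda^n\to\Omega/\Lambda$, $(a,b)\mapsto\overline{a}^tA^{-1}b$. The symbol $\cong$ means isometric. $V$ is a $2k\times2k$ Seifert matrix of the (oriented) knot $K$, with entries $\mathrm{lk}(v_i,v_j^+)$, $v_j^+$ the positive push-off. $\det(K)=(-1)^k\det(V+V^t)$, $\sigma(K)=\mathrm{sign}(V+V^t)$. The Blanchfield pairing $\lambda(K)$ on the Alexander module $H_1(X(K);\Lambda)$, $X(K)=S^3\setminus\nu K$, is $(a,b)\mapsto\Phi(a)(b)\in\Omega/\Lambda$, with $\Phi$ the composition $H_1(X(K);\Lambda)\to H_1(X(K),\partial X(K);\Lambda)\to\overline{H^2(X(K);\Lambda)}\xleftarrow{\cong}\overline{H^1(X(K);\Omega/\Lambda)}\to\overline{\mathrm{Hom}_\Lambda(H_1(X(K);\Lambda),\Omega/\Lambda)}$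 of inclusion, Poincaré duality, inverse Bockstein and evaluation. With these conventions (Kearton) it is isometric to the pairing on $\Lambda^{2k}/(Vt-V^t)\Lambda^{2k}$ given by $(a,b)\mapsto\overline{a}^t(t-1)(Vt-V^t)^{-1}b$. $n(K)$ is the minimal size of a hermitian matrix $A$ over $\Lambda$ such that $\lambda(A)\cong\lambda(K)$ and $A(1)$ is congruent over $\mathbb{Z}$ to a diagonal matrix with $\pm1$'s on the diagonal. $l(K)$ is the linking pairing $H_1(\Sigma(K);\mathbb{Z})\times H_1(\Sigma(K);\mathbb{Z})\to\mathbb{Q}/\mathbb{Z}$ of the 2-fold branched cover $\Sigma(K)$ of $K$; it is isometric to $(v,w)\mapsto v^t(V+V^t)^{-1}w$ on $\mathbb{Z}^{2k}/(V+V^t)\mathbb{Z}^{2k}$. For a symmetric integral $n\times n$ matrix $A$ with odd determinant, $l(A)$ is the pairing $\mathbb{Z}^n/A\mathbb{Z}^n\times\mathbb{Z}^n/A\mathbb{Z}^n\to\mathbb{Q}/\mathbb{Z}$, $(v,w)\mapsto v^tA^{-1}w$. For a linking pairing $l$, $(2l)(v,w)=2\cdot l(v,w)$. A matrix is $(+1)$-definite if positive definite and $(-1)$-definite if negative definite. *)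

(* Defs.v *)
From HB Require Import structures.
From mathcomp Require Import all_boot all_order all_algebra all_field.
From mathcomp Require Import boolp ring.

Set Implicit Arguments.
Unset Strict Implicit.
Unset Printing Implicit Defensive.

Import Order.TTheory GRing.Theory Num.Theory.

Local Open Scope ring_scope.
Local Open Scope quotient_scope.

(* Omega is Q(t), with t = tO; Lambda below is its subring Z[t, t^-1]. *)
Notation Omega := {fraction {poly rat}}.

Definition tO : Omega := tofrac 'X.

Definition polyO (p : {poly int}) : Omega := tofrac (map_poly intr p : {poly rat}).

Definition laurent : {pred Omega} :=
  fun x => `[< exists (p : {poly int}) (n : nat), x = tO ^- n * polyO p >].

Fact tO_neq0 : tO != 0.
Proof. by rewrite tofrac_eq0 polyX_eq0. Qed.

Fact polyOB : {morph polyO : p q / p - q}.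
Proof. by move=> p q; rewrite /polyO rmorphB /= tofracB. Qed.

Fact polyOD : {morph polyO : p q / p + q}.
Proof. by move=> p q; rewrite /polyO rmorphD /= tofracD. Qed.

Fact polyOM : {morph polyO : p q / p * q}.
Proof. by move=> p q; rewrite /polyO rmorphM /= tofracM. Qed.

Fact polyOX n : polyO ('X^n) = tO ^+ n.
Proof. by rewrite /polyO map_polyXn tofracXn. Qed.

Fact polyO1 : polyO 1 = 1.
Proof. by rewrite -(expr0 'X) polyOX expr0. Qed.

Fact polyO_inj : injective polyO.
Proof.
move=> p q /eqP; rewrite tofrac_eq => /eqP.
by apply: map_inj_poly => //; exact: intr_inj.
Qed.

Fact laurentP x : reflect
  (exists (p : {poly int}) (n : nat), x = tO ^- n * polyO p) (x \in laurent).
Proof. exact: asboolP. Qed.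

Fact laurent_frac_clear (x : Omega) p n :
  (x = tO ^- n * polyO p) <-> (tO ^+ n * x = polyO p).
Proof.
have tn0 : tO ^+ n != 0 by rewrite expf_neq0 ?tO_neq0.
by split=> [->|<-]; rewrite ?mulVKf ?mulKf.
Qed.

Fact laurent_subring : subring_closed laurent.
Proof.
split.
- by apply/laurentP; exists 1, 0; rewrite polyO1 expr0 invr1 mulr1.
- move=> x y /laurentP[p [n /laurent_frac_clear px]].
  move=> /laurentP[q [m /laurent_frac_clear qy]].
  apply/laurentP; exists ('X^m * p - 'X^n * q), (n + m)%N.
  apply/laurent_frac_clear.
  by rewrite polyOB !polyOM !polyOX -px -qy mulrBr !mulrA -!exprD addnC.
- move=> x y /laurentP[p [n /laurent_frac_clear px]].
  move=> /laurentP[q [m /laurent_frac_clear qy]].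
  apply/laurentP; exists (p * q), (n + m)%N; apply/laurent_frac_clear.
  by rewrite polyOM -px -qy exprD mulrACA.
Qed.

HB.instance Definition _ := GRing.isSubringClosed.Build Omega laurent
  laurent_subring.

Record Lambda := MkLambda { Lambda_val : Omega; _ : Lambda_val \in laurent }.

HB.instance Definition _ := [isSub for Lambda_val].
HB.instance Definition _ := [Choice of Lambda by <:].
HB.instance Definition _ := [SubChoice_isSubComNzRing of Lambda by <:].

Fact Lambda_val_eq0 (x : Lambda) : (\val x == 0) = (x == 0).
Proof. by rewrite -(inj_eq val_inj) rmorph0. Qed.

Fact tO_laurent : tO \in laurent.
Proof.
apply/laurentP; exists 'X, 0%N.
by rewrite expr0 invr1 mul1r -['X]expr1 polyOX expr1.
Qed.

Fact tOV_laurent : tO^-1 \in laurent.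
Proof. by apply/laurentP; exists 1, 1%N; rewrite polyO1 mulr1 expr1. Qed.

Definition tL : Lambda := MkLambda tO_laurent.
Definition tLV : Lambda := MkLambda tOV_laurent.

Fact tLK : tL * tLV = 1.
Proof. by apply: val_inj; rewrite /= mulfV ?tO_neq0. Qed.

Fact tLVK : tLV * tL = 1.
Proof. by rewrite mulrC tLK. Qed.

Fact Lambda_fracP (x : Lambda) :
  exists pn : {poly int} * nat, \val x = tO ^- pn.2 * polyO pn.1.
Proof. by case: x => x /= /laurentP[p [n ->]]; exists (p, n). Qed.

Definition Lambda_frac (x : Lambda) : {poly int} * nat :=
  projT1 (cid (Lambda_fracP x)).

(* The value of x at t = u, where v is the inverse of u: if x = t^-n p(t) with
   p in Z[t] then this is v^n p(u), by laurent_evalE below. *)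
Definition laurent_eval (S : comNzRingType) (u v : S) (x : Lambda) : S :=
  v ^+ (Lambda_frac x).2 * (map_poly intr (Lambda_frac x).1).[u].

Section LaurentEval.
Variables (S : comNzRingType) (u v : S).
Hypothesis uv1 : u * v = 1.

Lemma laurent_evalE (x : Lambda) (p : {poly int}) (n : nat) :
  \val x = tO ^- n * polyO p ->
  laurent_eval u v x = v ^+ n * (map_poly intr p).[u].
Proof.
move=> xE; rewrite /laurent_eval /Lambda_frac; case: cid => -[q m] /= xE'.
move/laurent_frac_clear: xE => xE; move/laurent_frac_clear: xE' => xE'.
have pq : 'X^n * q = 'X^m * p.
  by apply: polyO_inj; rewrite !polyOM !polyOX -xE -xE' mulrCA.
have /(congr1 (fun r : {poly int} => (map_poly intr r : {poly S}).[u])) := pq.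
rewrite !rmorphM /= !map_polyXn !hornerM !hornerXn => pqu.
have uvn k : u ^+ k * v ^+ k = 1 by rewrite -exprMn uv1 expr1n.
move: (uvn n) (uvn m) pqu.
move: (horner _ _) (horner _ _) (u ^+ n) (v ^+ n) (u ^+ m) (v ^+ m).
move=> P Q a b c d ab1 cd1 aQ.
transitivity (b * d * (a * Q)); last rewrite aQ.
  by rewrite -[LHS]mul1r -ab1; ring.
by rewrite -[RHS]mul1r -cd1; ring.
Qed.

End LaurentEval.

Section LaurentMorphism.
Variables (S : comNzRingType) (u v : S).
Hypothesis uv1 : u * v = 1.

Fact laurent_eval_zmod : zmod_morphism (laurent_eval u v).
Proof.
move=> x y; have [[p n] /= px] := Lambda_fracP x.
have [[q m] /= qy] := Lambda_fracP y.
have pqE : \val (x - y) = tO ^- (n + m) * polyO ('X^m * p - 'X^n * q).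
  apply/laurent_frac_clear.
  move/laurent_frac_clear: px => px; move/laurent_frac_clear: qy => qy.
  rewrite polyOB !polyOM !polyOX -px -qy rmorphB /= mulrBr !mulrA -!exprD.
  by rewrite addnC.
rewrite (laurent_evalE uv1 px) (laurent_evalE uv1 qy) (laurent_evalE uv1 pqE).
rewrite rmorphB !rmorphM /= !map_polyXn hornerD hornerN !hornerM !hornerXn exprD.
have un : u ^+ n * v ^+ n = 1 by rewrite -exprMn uv1 expr1n.
have um : u ^+ m * v ^+ m = 1 by rewrite -exprMn uv1 expr1n.
move: (horner _ _) (horner _ _) un um => P Q.
move: (u ^+ n) (v ^+ n) (u ^+ m) (v ^+ m) => a b c d ab1 cd1.
transitivity (c * d * (b * Q) - a * b * (d * P)); first by ring.
by rewrite ab1 cd1 !mul1r.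
Qed.

Fact laurent_eval_monoid : monoid_morphism (laurent_eval u v).
Proof.
split.
  have E1 : \val (1 : Lambda) = tO ^- 0 * polyO 1.
    by rewrite polyO1 mulr1 expr0 invr1.
  by rewrite (laurent_evalE uv1 E1) rmorph1 hornerC expr0 mulr1.
move=> x y; have [[p n] /= px] := Lambda_fracP x.
have [[q m] /= qy] := Lambda_fracP y.
have pqE : \val (x * y) = tO ^- (n + m) * polyO (p * q).
  apply/laurent_frac_clear.
  move/laurent_frac_clear: px => px; move/laurent_frac_clear: qy => qy.
  by rewrite polyOM -px -qy exprD mulrACA.
rewrite (laurent_evalE uv1 px) (laurent_evalE uv1 qy) (laurent_evalE uv1 pqE).
by rewrite rmorphM hornerM exprD mulrACA.
Qed.

End LaurentMorphism.

Definition Lambda_conj : Lambda -> Lambda := laurent_eval tLV tL.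
Definition Lambda_at1 : Lambda -> int := laurent_eval 1 1.

HB.instance Definition _ := GRing.isZmodMorphism.Build Lambda Lambda
  Lambda_conj (laurent_eval_zmod tLVK).
HB.instance Definition _ := GRing.isMonoidMorphism.Build Lambda Lambda
  Lambda_conj (laurent_eval_monoid tLVK).
HB.instance Definition _ := GRing.isZmodMorphism.Build Lambda int
  Lambda_at1 (laurent_eval_zmod (mulr1 1)).
HB.instance Definition _ := GRing.isMonoidMorphism.Build Lambda int
  Lambda_at1 (laurent_eval_monoid (mulr1 1)).

Fact tL_frac : \val tL = tO ^- 0 * polyO 'X.
Proof. by rewrite /= expr0 invr1 mul1r -['X]expr1 polyOX expr1. Qed.

Lemma Lambda_conj_t : Lambda_conj tL = tLV.
Proof.
by rewrite /Lambda_conj (laurent_evalE tLVK tL_frac) map_polyX hornerX mul1r.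
Qed.

Lemma Lambda_at1_t : Lambda_at1 tL = 1.
Proof.
by rewrite /Lambda_at1 (laurent_evalE _ tL_frac) ?mulr1 // map_polyX hornerX.
Qed.

Lemma Lambda_conjK : involutive Lambda_conj.
Proof.
have conj_tLV : Lambda_conj tLV = tL.
  rewrite -[LHS]mulr1 -tLVK -[X in _ * (X * _)]Lambda_conj_t mulrA -rmorphM.
  by rewrite tLVK rmorph1 mul1r.
have conjX k : Lambda_conj (tL ^+ k) = tLV ^+ k.
  by rewrite rmorphXn /= Lambda_conj_t.
have intE (c : int) : Lambda_conj c%:~R = c%:~R by rewrite rmorph_int.
have hornE (p : {poly int}) w :
    Lambda_conj (map_poly intr p).[w] = (map_poly intr p).[Lambda_conj w].
  rewrite -horner_map /= -map_poly_comp; congr (_.[_]).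
  by apply: eq_map_poly => c /=; rewrite intE.
move=> x; have [[p n] /= px] := Lambda_fracP x.
rewrite {2}/Lambda_conj (laurent_evalE tLVK px) rmorphM /=.
rewrite hornE conjX conj_tLV.
apply: val_inj; rewrite rmorphM rmorphXn /= [RHS]px exprVn; congr (_ * _).
elim/poly_ind: p {px} => [|p c IHp].
  by rewrite !rmorph0 horner0 [LHS]rmorph0 /polyO rmorph0 tofrac0.
rewrite rmorphD rmorphM /= map_polyX map_polyC hornerMXaddC polyOD polyOM -IHp.
rewrite -[LHS]/(\val _).
rewrite [LHS]rmorphD [X in X + _ = _]rmorphM -['X]expr1 polyOX expr1.
by congr (_ + _); rewrite [LHS]rmorph_int /polyO map_polyC /= !rmorph_int.
Qed.

Section Cokernel.
Variables (R : comNzRingType) (n : nat) (A : 'M[R]_n).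

Definition colspace : {pred 'cV[R]_n} :=
  fun v => `[< exists w : 'cV[R]_n, v = A *m w >].

Fact colspaceP v : reflect (exists w : 'cV[R]_n, v = A *m w) (v \in colspace).
Proof. exact: asboolP. Qed.

Fact colspace_zmod : zmod_closed colspace.
Proof.
split; first by apply/colspaceP; exists 0; rewrite mulmx0.
move=> _ _ /colspaceP[v ->] /colspaceP[w ->].
by apply/colspaceP; exists (v - w); rewrite mulmxBr.
Qed.

HB.instance Definition _ := GRing.isZmodClosed.Build 'cV[R]_n colspace
  colspace_zmod.

Definition coker : Type := Quotient.quot colspace.

HB.instance Definition _ := GRing.Zmodule.on coker.
HB.instance Definition _ := EqQuotient.on coker.

Fact coker_eq (v w : 'cV[R]_n) :
  \pi_coker v = \pi_coker w <-> exists x, v - w = A *m x.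
Proof.
split=> [/eqP|vw]; first by rewrite -Quotient.idealrBE => /colspaceP.
by apply/eqP; rewrite -Quotient.idealrBE; apply/colspaceP.
Qed.

Fact coker_piD (v w : 'cV[R]_n) :
  \pi_coker (v + w) = \pi_coker v + \pi_coker w.
Proof. exact: (@Quotient.pi_add _ colspace). Qed.

Definition coker_scale (a : R) (x : coker) : coker :=
  \pi_coker (a *: repr x).

Fact coker_piZ a v : \pi_coker (a *: v) = coker_scale a (\pi_coker v).
Proof.
have /coker_eq[x xE] : \pi_coker v = \pi_coker (repr (\pi_coker v)).
  by rewrite reprK.
by apply/coker_eq; exists (a *: x); rewrite -scalerBr xE scalemxAr.
Qed.

Fact coker_scaleA a b x :
  coker_scale a (coker_scale b x) = coker_scale (a * b) x.
Proof.
by elim/quotW: x => v; rewrite -(coker_piZ b v) -(coker_piZ a (b *: v)) -(coker_piZ _ v) scalerA.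
Qed.

Fact coker_scale1 : left_id 1 coker_scale.
Proof. by elim/quotW=> v; rewrite -(coker_piZ 1 v) scale1r. Qed.

Fact coker_scaleDr : right_distributive coker_scale +%R.
Proof.
move=> a; elim/quotW=> v; elim/quotW=> w.
by rewrite -coker_piD -(coker_piZ a (v + w)) -(coker_piZ a v) -(coker_piZ a w) scalerDr coker_piD.
Qed.

Fact coker_scaleDl x : {morph coker_scale^~ x : a b / a + b}.
Proof.
by elim/quotW: x => v a b; rewrite -(coker_piZ (a + b) v) -(coker_piZ a v) -(coker_piZ b v) scalerDl coker_piD.
Qed.

HB.instance Definition _ := GRing.Zmodule_isLmodule.Build R coker
  coker_scaleA coker_scale1 coker_scaleDr coker_scaleDl.

End Cokernel.

Section Pairing.
Variables (R : comNzRingType) (F : fieldType) (iota : {rmorphism R -> F}).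

Definition integral : {pred F} := fun x => `[< exists r, x = iota r >].

Fact integralP x : reflect (exists r, x = iota r) (x \in integral).
Proof. exact: asboolP. Qed.

Fact integral_zmod : zmod_closed integral.
Proof.
split; first by apply/integralP; exists 0; rewrite rmorph0.
move=> _ _ /integralP[r ->] /integralP[s ->].
by apply/integralP; exists (r - s); rewrite rmorphB.
Qed.

HB.instance Definition _ := GRing.isZmodClosed.Build F integral integral_zmod.

Definition quot_field : Type := Quotient.quot integral.

HB.instance Definition _ := GRing.Zmodule.on quot_field.
HB.instance Definition _ := EqQuotient.on quot_field.

Fact quot_field_eq (x y : F) :
  \pi_quot_field x = \pi_quot_field y <-> exists r, x - y = iota r.
Proof.
split=> [/eqP|xy]; first by rewrite -Quotient.idealrBE => /integralP.
by apply/eqP; rewrite -Quotient.idealrBE; apply/integralP.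
Qed.

(* The pairing (a, b) |-> conj(a)^t B b on R^n / A R^n, computed on
   representatives. It does not depend on them as soon as B A and conj(A)^t B
   have entries in R: see coker_pairing_pi. *)
Definition coker_pairing (conj : R -> R) (n : nat) (A : 'M[R]_n) (B : 'M[F]_n)
    (a b : coker A) : quot_field :=
  \pi_quot_field (((map_mx iota (map_mx conj (repr a)))^T *m B *m map_mx iota (repr b)) 0 0).

Lemma coker_pairing_pi (conj : {rmorphism R -> R}) (n : nat)
    (A X Y : 'M[R]_n) (B : 'M[F]_n) (a b : 'cV[R]_n) :
  B *m map_mx iota A = map_mx iota X ->
  (map_mx iota (map_mx conj A))^T *m B = map_mx iota Y ->
  coker_pairing conj B (\pi_(coker A) a) (\pi_(coker A) b) =
  \pi_quot_field (((map_mx iota (map_mx conj a))^T *m B *m map_mx iota b) 0 0).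
Proof.
move=> BA AB; rewrite /coker_pairing.
have /coker_eq[x /eqP] : \pi_(coker A) (repr (\pi_(coker A) a)) = \pi_(coker A) a.
  by rewrite reprK.
have /coker_eq[y /eqP] : \pi_(coker A) (repr (\pi_(coker A) b)) = \pi_(coker A) b.
  by rewrite reprK.
rewrite !subr_eq => /eqP-> /eqP->; apply/quot_field_eq.
set a' := map_mx conj a; set x' := map_mx conj x.
exists ((x'^T *m Y *m (A *m y + b) + a'^T *m X *m y) 0 0).
rewrite [RHS](_ : _ = (map_mx iota
  (x'^T *m Y *m (A *m y + b) + a'^T *m X *m y)) 0 0); last by rewrite [RHS]mxE.
have subE (M N : 'M[F]_1) : M 0 0 - N 0 0 = (M - N) 0 0 by rewrite !mxE.
rewrite subE; congr (fun_of_matrix _ 0 0).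
rewrite !(map_mxD, map_mxM) /= !linearD /= !trmx_mul -!map_trmx.
rewrite -AB -BA -/a' -/x' !(mulmxDl, mulmxDr) !mulmxA.
by rewrite !addrA addrK addrAC.
Qed.

Definition inv_pairing (conj : R -> R) (n : nat) (A : 'M[R]_n) :
    coker A -> coker A -> quot_field :=
  coker_pairing conj (invmx (map_mx iota A)).

End Pairing.

Definition isometric (R : pzRingType) (M M' : lmodType R) (Q : Type)
    (b : M -> M -> Q) (b' : M' -> M' -> Q) : Prop :=
  exists f : {linear M -> M'},
    bijective f /\ forall x y, b' (f x) (f y) = b x y.

Notation OmegaModLambda := (quot_field (val : {rmorphism Lambda -> Omega})).
Notation QmodZ := (quot_field (intr : {rmorphism int -> rat})).

Definition hermitian_mx (n : nat) (A : 'M[Lambda]_n) : Prop :=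
  (map_mx Lambda_conj A)^T = A.

Definition lambda_mx (n : nat) (A : 'M[Lambda]_n) :
    coker A -> coker A -> OmegaModLambda :=
  inv_pairing val Lambda_conj (A := A).

Definition linking_mx (n : nat) (A : 'M[int]_n) : coker A -> coker A -> QmodZ :=
  inv_pairing intr idfun (A := A).

Lemma lambda_mx_pi (n : nat) (A : 'M[Lambda]_n) (a b : 'cV[Lambda]_n) :
  hermitian_mx A -> \det A != 0 ->
  lambda_mx (\pi_(coker A) a) (\pi_(coker A) b) =
  \pi_OmegaModLambda (((map_mx val (map_mx Lambda_conj a))^T *m invmx (map_mx val A)
        *m map_mx val b) 0 0).
Proof.
move=> hA dA; have uA : map_mx val A \in unitmx.
  by rewrite unitmxE det_map_mx unitfE Lambda_val_eq0.
apply: (@coker_pairing_pi _ _ _ Lambda_conj n A 1%:M 1%:M).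
  by rewrite mulVmx // map_mx1.
by rewrite map_trmx hA mulmxV // map_mx1.
Qed.

Lemma linking_mx_pi (n : nat) (A : 'M[int]_n) (a b : 'cV[int]_n) :
  A^T = A -> \det A != 0 ->
  linking_mx (\pi_(coker A) a) (\pi_(coker A) b) =
  \pi_QmodZ (((map_mx intr a)^T *m invmx (map_mx intr A) *m map_mx intr b) 0 0).
Proof.
move=> hA dA; have uA : map_mx (intr : int -> rat) A \in unitmx.
  by rewrite unitmxE det_map_mx unitfE intr_eq0.
rewrite (_ : map_mx intr a = map_mx intr (map_mx idfun a)); last first.
  by rewrite map_mx_id.
apply: (@coker_pairing_pi _ _ _ idfun n A 1%:M 1%:M).
  by rewrite mulVmx // map_mx1.
by rewrite map_mx_id // map_trmx hA mulmxV // map_mx1.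
Qed.

(* V - V^T is the matrix of the intersection form of a Seifert surface, a
   surface of genus k with one boundary circle. Conversely every V with this
   property is a Seifert matrix of some knot. *)
Definition seifert_matrix (k : nat) (V : 'M[int]_(2 * k)) : Prop :=
  \det (V - V^T) = 1.

Definition knot_det (k : nat) (V : 'M[int]_(2 * k)) : int :=
  (-1) ^+ k * \det (V + V^T).

Definition signature (n : nat) (S : 'M[int]_n) : int :=
  let d := spectral_diag (map_mx intr S : 'M[algC]_n) in
  #|[set i | 0 < d 0 i]|%:Z - #|[set i | d 0 i < 0]|%:Z.

Definition knot_signature (k : nat) (V : 'M[int]_(2 * k)) : int :=
  signature (V + V^T).

(* V + V^T presents H_1 of the 2-fold branched cover; the linking pairing on it
   is then given by the inverse matrix. *)
Definition knot_linking (k : nat) (V : 'M[int]_(2 * k)) :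
    coker (V + V^T) -> coker (V + V^T) -> QmodZ :=
  linking_mx (A := V + V^T).

Definition alexander_mx (k : nat) (V : 'M[int]_(2 * k)) : 'M[Lambda]_(2 * k) :=
  tL *: map_mx intr V - (map_mx intr V)^T.

(* Kearton's formula for the Blanchfield pairing on the Alexander module, which
   is presented by V t - V^T. *)
Definition blanchfield (k : nat) (V : 'M[int]_(2 * k)) :
    coker (alexander_mx V) -> coker (alexander_mx V) -> OmegaModLambda :=
  coker_pairing val Lambda_conj
    ((tO - 1) *: invmx (map_mx val (alexander_mx V))).

Lemma alexander_mx_unit (k : nat) (V : 'M[int]_(2 * k)) :
  seifert_matrix V -> map_mx (val : Lambda -> Omega) (alexander_mx V) \in unitmx.
Proof.
move=> hV; rewrite unitmxE det_map_mx unitfE Lambda_val_eq0.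
apply/eqP => /(congr1 Lambda_at1); rewrite -det_map_mx rmorph0.
rewrite (_ : map_mx _ _ = V - V^T) ?hV //.
apply/matrixP => i j; rewrite !mxE rmorphB rmorphM /= Lambda_at1_t mul1r.
by rewrite !rmorph_int !intz.
Qed.

Lemma blanchfield_pi (k : nat) (V : 'M[int]_(2 * k)) (a b : 'cV[Lambda]_(2 * k)) :
  seifert_matrix V ->
  blanchfield (\pi_(coker (alexander_mx V)) a) (\pi_(coker (alexander_mx V)) b) =
  \pi_OmegaModLambda (((map_mx val (map_mx Lambda_conj a))^T
        *m ((tO - 1) *: invmx (map_mx val (alexander_mx V)))
        *m map_mx val b) 0 0).
Proof.
move=> hV; have uA := alexander_mx_unit hV.
have conjA : (map_mx Lambda_conj (alexander_mx V))^T = - tLV *: alexander_mx V.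
  apply/matrixP => i j; rewrite !mxE rmorphB rmorphM /= Lambda_conj_t.
  rewrite !rmorph_int; move: (V j i)%:~R (V i j)%:~R => p q.
  by rewrite -[q in LHS]mul1r -tLVK; ring.
apply: (@coker_pairing_pi _ _ _ Lambda_conj _ _ (tL - 1)%:M (tLV * (1 - tL))%:M).
  by rewrite -scalemxAl mulVmx // map_scalar_mx scalemx1.
rewrite map_trmx conjA map_mxZ -scalemxAl -scalemxAr mulmxV // scalerA.
rewrite scalemx1 map_scalar_mx; congr (_%:M).
transitivity (tO^-1 * (1 - tO)); last by [].
by rewrite -[LHS]/(- tO^-1 * (tO - 1)); ring.
Qed.

Definition presents_blanchfield (k : nat) (V : 'M[int]_(2 * k)) (n : nat)
    (A : 'M[Lambda]_n) : Prop :=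
  [/\ hermitian_mx A, \det A != 0,
      isometric (lambda_mx (A := A)) (blanchfield (V := V)) &
      exists (P : 'M[int]_n) (d : 'rV[int]_n),
        [/\ P \in unitmx, forall i, d 0 i = 1 \/ d 0 i = -1 &
            P^T *m map_mx Lambda_at1 A *m P = diag_mx d]].

(* n(K) = n, where n(K) is the minimum over all sizes m, including m = 0. *)
Definition knot_n_is (k : nat) (V : 'M[int]_(2 * k)) (n : nat) : Prop :=
  (exists A : 'M[Lambda]_n, presents_blanchfield V A) /\
  (forall (m : nat) (A : 'M[Lambda]_m), presents_blanchfield V A -> (n <= m)%N).

(* Definiteness is tested on vectors over every ordered field, in particular
   over the reals. *)
Definition definite (eps : int) (n : nat) (A : 'M[int]_n) : Prop :=
  forall (R : realFieldType) (x : 'cV[R]_n), x != 0 ->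
    0 < eps%:~R * (x^T *m map_mx intr A *m x) 0 0.

(* Main.v *)
(* Take A(t) of size n with lambda(A) isometric to the Blanchfield pairing and
   evaluate at t = -1. Kearton's matrix (t - 1)(Vt - V^t)^-1 becomes
   2 (V + V^t)^-1, which gives the linking form and the determinant; the
   congruences come from x(-1) = x(1) mod 2, and mod 4 if x(t) = x(1/t).

   For the definiteness, gluing A to the form of V along the isometry of
   cokernels gives a hermitian matrix over Lambda whose determinant is a unit
   times a power of t - 1. Its inertia is therefore constant on the unit circle
   away from 1, and comparing t = -1 with t near 1 yields
   sign(V + V^t) = sign A(-1) - sign A(1). If the left side is 2n eps, then
   A(-1) is eps-definite and A(1) is (-eps)-definite. Everything takes place
   over algC: instead of continuity, explicit Lipschitz bounds for Laurent
   polynomials and bounds for inverse matrices allow finitely many steps along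
   the circle. *)

From HB Require Import structures.
Require Import Defs.
From mathcomp Require Import all_boot all_order all_algebra.
From mathcomp Require Import all_field boolp.
From mathcomp Require Import ring zify.

Set Implicit Arguments.
Unset Strict Implicit.
Unset Printing Implicit Defensive.

Import Order.TTheory GRing.Theory Num.Theory.

Local Open Scope ring_scope.
Local Open Scope quotient_scope.
Local Open Scope sesquilinear_scope.

(** * Positive index of hermitian forms *)

(** A torsion pairing with values in [Omega] modulo [Lambda] cannot be evaluated at a number. The
    isometry is therefore replaced by matrix identities over [Lambda]: lifts [F], [F'] to free
    modules, and a matrix [X] that records the integral difference of the two pairings. Such
    identities survive every ring morphism, and the same matrices supply the glued form.

    Inertia enters only through one-sided bounds: some subspace of dimension p is positive. They add
    over orthogonal sums, pass forward along congruences and survive small perturbations of a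
    nondegenerate form. The count closes because the signature is extremal. For eps = 1 the Seifert
    form contributes k positive directions near t = 1 and k + n negative ones at t = -1; this
    already fills the dimension n + 2k of the glued form and leaves no room for a positive direction
    of A(1) or a negative one of A(-1).

    The point t = 1, where the glued form may degenerate, is only approached. *)

Section HermitianForms.
Variable C : numClosedFieldType.

Definition hform n (H : 'M[C]_n) (u : 'rV[C]_n) : C := (u *m H *m u^t*) 0 0.

(** A lower bound only; the rows of [U] are independent because the form vanishes at 0. Maximality
    is [pos_index_le_num_pos]. *)
Definition pos_index_ge n (H : 'M[C]_n) (p : nat) : Prop :=
  exists U : 'M[C]_(p, n), forall u : 'rV_p, u != 0 -> 0 < hform H (u *m U).

Lemma hform0 n (H : 'M[C]_n) : hform H 0 = 0.
Proof. by rewrite /hform !mul0mx mxE. Qed.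

Lemma hformN n (H : 'M[C]_n) u : hform (- H) u = - hform H u.
Proof. by rewrite /hform mulmxN mulNmx mxE. Qed.

Lemma hformD n (H H' : 'M[C]_n) u : hform (H + H') u = hform H u + hform H' u.
Proof. by rewrite /hform mulmxDr mulmxDl mxE. Qed.

Lemma hformZ n (a : C) (H : 'M[C]_n) u : hform (a *: H) u = a * hform H u.
Proof. by rewrite /hform -scalemxAr -scalemxAl mxE. Qed.

Lemma hform_congr m n (W : 'M[C]_(m, n)) (H : 'M[C]_n) u :
  hform (W *m H *m W^t*) u = hform H (u *m W).
Proof. by rewrite /hform trmx_mul map_mxM !mulmxA. Qed.

Lemma hform_diag n (d u : 'rV[C]_n) :
  hform (diag_mx d) u = \sum_i d 0 i * `|u 0 i| ^+ 2.
Proof.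
rewrite /hform mul_mx_diag mxE; apply: eq_bigr => i _.
by rewrite !mxE normCK mulrCA mulrA.
Qed.

Lemma hform_block n n' (H : 'M[C]_n) (H' : 'M[C]_n') u u' :
  hform (block_mx H 0 0 H') (row_mx u u') = hform H u + hform H' u'.
Proof.
rewrite /hform mul_row_block tr_row_mx map_col_mx mul_row_col.
by rewrite !mulmx0 addr0 add0r mxE.
Qed.

(** A nonzero common vector would make the form both positive and negative, so the two row spaces
    meet in 0. *)
Lemma pos_index_add n (H : 'M[C]_n) p q :
  pos_index_ge H p -> pos_index_ge (- H) q -> (p + q <= n)%N.
Proof.
move=> [U Upos] [W Wneg].
have free r (Z : 'M[C]_(r, n)) : (forall u : 'rV_r, u != 0 -> u *m Z != 0) -> \rank Z = r.
  move=> Z0; apply/eqP; rewrite -[_ == _]/(row_free Z) -kermx_eq0.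
  apply/eqP/row_matrixP => i; rewrite row0; apply: contraTeq isT => /Z0.
  by rewrite -row_mul mulmx_ker row0 eqxx.
have UN0 : forall u : 'rV_p, u != 0 -> u *m U != 0.
  by move=> u /Upos; apply: contraTneq => ->; rewrite hform0 ltxx.
have WN0 : forall u : 'rV_q, u != 0 -> u *m W != 0.
  by move=> u /Wneg; apply: contraTneq => ->; rewrite hform0 ltxx.
rewrite -[in X in (X <= _)%N](free _ _ UN0) -(free _ _ WN0) -mxrank_sum_cap.
suff -> : (U :&: W = 0)%MS by rewrite mxrank0 addn0 rank_leq_col.
apply/row_matrixP => i; rewrite row0; apply/eqP; apply: contraTT isT => v0.
have := row_sub i (U :&: W)%MS; rewrite sub_capmx.
case/andP=> /submxP[a aE] /submxP[b bE].
have /Upos : a != 0 by apply: contraNneq v0; rewrite aE => ->; rewrite mul0mx.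
have /Wneg : b != 0 by apply: contraNneq v0; rewrite bE => ->; rewrite mul0mx.
by rewrite -aE -bE hformN oppr_gt0 => /lt_trans h /h; rewrite ltxx.
Qed.

Lemma pos_index_block n n' (H : 'M[C]_n) (H' : 'M[C]_n') p p' :
  pos_index_ge H p -> pos_index_ge H' p' -> pos_index_ge (block_mx H 0 0 H') (p + p').
Proof.
move=> [U Upos] [U' U'pos]; exists (block_mx U 0 0 U') => u u0.
rewrite -[u]hsubmxK mul_row_block !mulmx0 addr0 add0r hform_block.
have ge0 (r m : nat) (K : 'M[C]_m) (Z : 'M[C]_(r, m)) v :
    (forall w : 'rV_r, w != 0 -> 0 < hform K (w *m Z)) -> 0 <= hform K (v *m Z).
  move=> KZ; have [->|/KZ/ltW//] := eqVneq v 0.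
  by rewrite mul0mx hform0.
have [l0|l0] := eqVneq (lsubmx u) 0.
  rewrite ltr_wpDl ?ge0 // U'pos //; apply: contraNneq u0 => r0.
  by rewrite -[u]hsubmxK l0 r0 row_mx0.
by rewrite ltr_wpDr ?ge0 // Upos.
Qed.

(** [W] may be singular or rectangular: positivity of the pulled back form makes it injective on the
    subspace. *)
Lemma pos_index_congr m n (W : 'M[C]_(m, n)) (H : 'M[C]_n) p :
  pos_index_ge (W *m H *m W^t*) p -> pos_index_ge H p.
Proof. by move=> [U Upos]; exists (U *m W) => u /Upos; rewrite hform_congr mulmxA. Qed.

Lemma pos_index_scale n (a : C) (H : 'M[C]_n) p :
  0 < a -> pos_index_ge H p -> pos_index_ge (a *: H) p.
Proof. by move=> a0 [U Upos]; exists U => u /Upos; rewrite hformZ pmulr_rgt0. Qed.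

(** * Eigenvalue estimates *)

Definition num_pos n (H : 'M[C]_n) : nat := #|[set i | 0 < spectral_diag H 0 i]|.

Lemma spectral_form n (H : 'M[C]_n) u : H \is hermsymmx ->
  hform H (u *m spectralmx H) = hform (diag_mx (spectral_diag H)) u.
Proof.
move=> /hermitian_normalmx/orthomx_spectralP HE.
rewrite {1}HE -hform_congr; congr hform.
by rewrite invmx_unitary ?spectral_unitarymx // !mulmxA mulmxtVK ?spectral_unitarymx //
  (unitarymxP _ ) ?spectral_unitarymx // mul1mx.
Qed.

Definition nsq n (u : 'rV[C]_n) : C := \sum_i `|u 0 i| ^+ 2.

Lemma nsq_gt0 n (u : 'rV[C]_n) : u != 0 -> 0 < nsq u.
Proof.
move=> u0; rewrite lt_def sumr_ge0 ?andbT => [|i _]; last by rewrite exprn_ge0.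
apply: contraNneq u0 => /eqP; rewrite psumr_eq0 => [/allP u0|i _]; last first.
  by rewrite exprn_ge0.
apply/eqP/rowP => i; rewrite mxE; apply/eqP.
by have := u0 i (mem_index_enum i); rewrite sqrf_eq0 normr_eq0.
Qed.

Lemma nsq_hform n (u : 'rV[C]_n) : nsq u = hform 1%:M u.
Proof.
rewrite -diag_const_mx hform_diag; apply: eq_bigr => i _.
by rewrite mxE mul1r.
Qed.

Lemma nsq_unitary m n (u : 'rV[C]_m) (P : 'M[C]_(m, n)) :
  P \is unitarymx -> nsq (u *m P) = nsq u.
Proof. by move=> /unitarymxP PU; rewrite !nsq_hform -hform_congr mulmx1 PU. Qed.

Lemma hform_bound n (E : 'M[C]_n) (e : C) (v : 'rV[C]_n) :
  (forall i j, `|E i j| <= e) -> `|hform E v| <= n%:R * e * nsq v.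
Proof.
move=> Ee.
have -> : hform E v = \sum_j \sum_i v 0 i * E i j * (v 0 j)^*.
  rewrite /hform mxE; apply: eq_bigr => j _; rewrite !mxE mulr_suml.
  by apply: eq_bigr => i _.
apply: le_trans (ler_norm_sum _ _ _) _.
apply: (@le_trans _ _ (\sum_j \sum_i e * ((`|v 0 i| ^+ 2 + `|v 0 j| ^+ 2) / 2))).
  apply: ler_sum => j _; apply: le_trans (ler_norm_sum _ _ _) _.
  apply: ler_sum => i _; rewrite !normrM norm_conjC.
  have e0 : 0 <= e by apply: le_trans (Ee i j).
  apply: (@le_trans _ _ (e * (`|v 0 i| * `|v 0 j|))).
    by rewrite mulrAC [leRHS]mulrC ler_wpM2l ?mulr_ge0.
  rewrite ler_wpM2l // ler_pdivlMr // -subr_ge0.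
  have -> : `|v 0 i| ^+ 2 + `|v 0 j| ^+ 2 - `|v 0 i| * `|v 0 j| * 2 = (`|v 0 i| - `|v 0 j|) ^+ 2.
    by ring.
  by rewrite real_exprn_even_ge0 // realB ?normr_real.
under eq_bigr do rewrite -mulr_sumr -mulr_suml.
rewrite -mulr_sumr -mulr_suml.
under eq_bigr do rewrite big_split /= sumr_const card_ord.
rewrite big_split /= sumr_const card_ord -/(nsq v) sumrMnl -/(nsq v).
set s := nsq v; suff -> : e * ((s *+ n + s *+ n) / 2) = n%:R * e * s by [].
by rewrite -mulr2n -[s *+ n *+ 2]mulr_natr mulfK ?pnatr_eq0 // -mulr_natl; ring.
Qed.

Lemma hermsymN n (H : 'M[C]_n) : H \is hermsymmx -> - H \is hermsymmx.
Proof.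
move=> /is_hermitianmxP HH; apply/is_hermitianmxP.
by rewrite {1}HH !expr0 !scale1r linearN /= map_mxN.
Qed.

(** On the span of the eigenvectors indexed by [A], the form of [a *: H] is at least [c] times the
    squared norm and outweighs the difference [H' - a *: H]. With difference 0, [a = 1] and [a = -1]
    give the positive and negative eigenspaces; a small difference gives stability. *)
Lemma spectral_pos n (H H' : 'M[C]_n) (A : {set 'I_n}) (a c : C) :
  H \is hermsymmx -> (forall i, i \in A -> c <= a * spectral_diag H 0 i) ->
  (forall u, u != 0 -> - (c * nsq u) < hform (H' - a *: H) u) ->
  pos_index_ge H' #|A|.
Proof.
move=> HH cA H'H; pose P := spectralmx H.
pose E : 'M[C]_(#|A|, n) := \matrix_(j, i) (enum_val j == i)%:R.
have EU : E \is unitarymx.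
  apply/unitarymxP/matrixP => i j; rewrite !mxE (bigD1 (enum_val i)) //= !mxE.
  rewrite eqxx mul1r big1 => [|l /negPf li]; last first.
    by rewrite !mxE eq_sym li mul0r.
  by rewrite addr0 rmorph_nat (inj_eq enum_val_inj) eq_sym.
have PU : P \is unitarymx by rewrite spectral_unitarymx.
exists (E *m P) => u u0.
have -> : H' = a *: H + (H' - a *: H) by rewrite addrC subrK.
have unz : u *m (E *m P) != 0.
  apply: contraNneq u0 => uE.
  by rewrite -[u](mulmxtVK _ (mul_unitarymx EU PU)) uE mul0mx.
rewrite hformD hformZ -[X in X < _](addrN (c * nsq u)) ler_ltD //; last first.
  by rewrite -(nsq_unitary u (mul_unitarymx EU PU)) H'H.
rewrite [u *m _]mulmxA spectral_form // hform_diag -(nsq_unitary u EU) /nsq !mulr_sumr.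
apply: ler_sum => i _; rewrite mulrA.
have [iA|iA] := boolP (i \in A); first by rewrite ler_wpM2r ?cA ?exprn_ge0.
suff -> : (u *m E) 0 i = 0 by rewrite normr0 expr0n /= !mulr0.
rewrite mxE big1 // => j _; rewrite mxE; case: eqP => [ji|_]; last by rewrite mulr0.
by case/negP: iA; rewrite -ji enum_valP.
Qed.

(** In the eigenbasis of [H] the inverse [K] is diagonal too, so the inverse eigenvalue is the value
    of the form of [K] at a unit eigenvector, and [hform_bound] applies. *)
Lemma spectral_inv n (H K : 'M[C]_n) (i : 'I_n) (M : C) :
  H \is hermsymmx -> H *m K = 1%:M -> (forall i j, `|K i j| <= M) ->
  spectral_diag H 0 i != 0 /\ `|(spectral_diag H 0 i)^-1| <= n%:R * M.
Proof.
move=> HH HK KM; pose P := spectralmx H; pose d := spectral_diag H.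
have PU : P \is unitarymx by rewrite spectral_unitarymx.
have HE : P *m H = diag_mx d *m P.
  have /hermitian_normalmx/orthomx_spectralP -> := HH.
  by rewrite -mulmxA mulKVmx ?spectral_unit.
have PE : P *m K *m P^t* = diag_mx (\row_j (d 0 j)^-1) /\ d 0 i != 0.
  have d1 : diag_mx d *m (P *m K *m P^t*) = 1%:M.
    by rewrite !mulmxA -HE -[P *m H *m K]mulmxA HK mulmx1 (unitarymxP _).
  have dn0 j : d 0 j != 0.
    have := congr1 (fun Z : 'M_n => Z j j) d1; rewrite mul_diag_mx !mxE eqxx.
    by apply: contra_eqN => /eqP->; rewrite mul0r eq_sym oner_eq0.
  split=> //; apply/matrixP => a b; have := congr1 (fun Z : 'M_n => Z a b) d1.
  rewrite mul_diag_mx !mxE => dE; apply: (mulfI (dn0 a)); rewrite dE.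
  by case: eqP => _; rewrite ?mulr0n ?mulr0 ?mulr1n ?mulfV.
case: PE => PE di; split=> //.
have -> : (spectral_diag H 0 i)^-1 = hform K (delta_mx 0 i *m P).
  rewrite -hform_congr PE hform_diag (bigD1 i) //= big1 => [|j /negPf ji].
    by rewrite !mxE !eqxx normr1 expr1n mulr1 addr0.
  by rewrite !mxE ji andbF normr0 expr0n mulr0.
rewrite (le_trans (hform_bound _ KM)) // nsq_unitary //.
rewrite /nsq (bigD1 i) //= big1 => [|j /negPf ji].
  by rewrite !mxE !eqxx normr1 expr1n addr0 mulr1.
by rewrite !mxE ji andbF normr0 expr0n.
Qed.

Lemma spectral_gap n (H K : 'M[C]_n) (i : 'I_n) (M : C) :
  H \is hermsymmx -> H *m K = 1%:M -> (forall i j, `|K i j| <= M) -> 0 <= M ->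
  (n%:R * M + 1)^-1 <= `|spectral_diag H 0 i|.
Proof.
move=> HH HK KM M0; have [d0] := spectral_inv i HH HK KM.
rewrite normfV => dM; rewrite -[leRHS]invrK lef_pV2 ?posrE ?invr_gt0 ?normr_gt0 //.
  by rewrite (le_trans dM) // lerDl ler01.
by rewrite ltr_wpDl ?ltr01 // mulr_ge0.
Qed.

Lemma hform_real n (H : 'M[C]_n) u : H \is hermsymmx -> hform H u \is Num.real.
Proof.
move=> /is_hermitianmxP; rewrite expr0 scale1r => HH; apply/CrealP.
rewrite /hform; set X := _ *m _.
have -> : (X 0 0)^* = (X^t*) 0 0 by rewrite !mxE.
by rewrite /X !trmx_mul !map_mxM trmxCK -HH mulmxA.
Qed.

Lemma hermsymB n (H H' : 'M[C]_n) :
  H \is hermsymmx -> H' \is hermsymmx -> H - H' \is hermsymmx.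
Proof.
move=> /is_hermitianmxP HH /is_hermitianmxP HH'; apply/is_hermitianmxP.
by rewrite {1}HH {1}HH' !expr0 !scale1r linearB /= map_mxB.
Qed.

Lemma pos_index_mono n (H : 'M[C]_n) p q :
  (p <= q)%N -> pos_index_ge H q -> pos_index_ge H p.
Proof.
move=> pq [U Upos]; exists ((pid_mx p : 'M_(p, q)) *m U) => u u0.
rewrite mulmxA Upos //; apply: contraNneq u0 => uE.
rewrite -[u]mulmx1 -(pid_mx_1 _ p) -(@pid_mx_id _ p q p p) // mulmxA uE mul0mx //.
Qed.

Definition num_neg n (H : 'M[C]_n) : nat := #|[set i | spectral_diag H 0 i < 0]|.

Section Nondegenerate.
Variables (n : nat) (H K : 'M[C]_n).
Hypotheses (HH : H \is hermsymmx) (HK : H *m K = 1%:M).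

Let M := \sum_i \sum_j `|K i j|.

Let M0 : 0 <= M. Proof. by rewrite sumr_ge0 // => i _; rewrite sumr_ge0. Qed.

Let KM i j : `|K i j| <= M.
Proof.
rewrite /M (bigD1 i) //= (bigD1 j) //= -addrA lerDl addr_ge0 // ?sumr_ge0 // => l _.
by rewrite sumr_ge0.
Qed.

Let c0 : 0 < (n%:R * M + 1)^-1.
Proof. by rewrite invr_gt0 ltr_wpDl ?ltr01 // mulr_ge0. Qed.

Lemma num_posP : pos_index_ge H (num_pos H).
Proof.
apply: (spectral_pos (a := 1) (c := (n%:R * M + 1)^-1) HH) => [i|u u0].
  by rewrite inE mul1r => /gtr0_norm <-; apply: spectral_gap KM M0.
by rewrite scale1r subrr /hform mulmx0 mul0mx mxE oppr_lt0 mulr_gt0 ?nsq_gt0.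
Qed.

Lemma num_negP : pos_index_ge (- H) (num_neg H).
Proof.
apply: (spectral_pos (a := -1) (c := (n%:R * M + 1)^-1) HH) => [i|u u0].
  by rewrite inE mulN1r => /ltr0_norm <-; apply: spectral_gap KM M0.
by rewrite scaleN1r opprK addNr /hform mulmx0 mul0mx mxE oppr_lt0 mulr_gt0 ?nsq_gt0.
Qed.

Lemma num_posneg : (num_pos H + num_neg H)%N = n.
Proof.
have dR i : spectral_diag H 0 i \is Num.real by apply/mxOverP/hermitian_spectral_diag_real.
rewrite /num_neg (_ : [set i | spectral_diag H 0 i < 0] = ~: [set i | 0 < spectral_diag H 0 i]).
  by rewrite /num_pos cardsC card_ord.
apply/setP => i; rewrite !inE -real_leNgt ?real0 // le_eqVlt.
by rewrite (negPf (proj1 (spectral_inv i HH HK KM))).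
Qed.

(** The positive subspace is played against the negative eigenspace, whose dimension is
    [n - num_pos H]. *)
Lemma pos_index_le_num_pos p : pos_index_ge H p -> (p <= num_pos H)%N.
Proof.
move=> Hp; have := pos_index_add Hp num_negP.
by rewrite -[in X in (_ <= X)%N]num_posneg leq_add2r.
Qed.
End Nondegenerate.

(* A hermitian perturbation smaller than the inverse of the operator norm of
   [H^-1] cannot destroy positive directions. *)
Lemma pos_index_perturb n (H K H' : 'M[C]_n) (M e : C) p :
  H \is hermsymmx -> H' \is hermsymmx -> H *m K = 1%:M ->
  (forall i j, `|K i j| <= M) -> 0 <= M ->
  (forall i j, `|H' i j - H i j| <= e) -> n%:R * e * (n%:R * M + 1) < 1 ->
  pos_index_ge H p -> pos_index_ge H' p.
Proof.
move=> HH HH' HK KM M0 He small /(pos_index_le_num_pos HH HK) pH.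
apply: pos_index_mono pH _.
apply: (spectral_pos (a := 1) (c := (n%:R * M + 1)^-1) HH) => [i|u u0].
  by rewrite inE mul1r => /gtr0_norm <-; apply: spectral_gap KM M0.
have hR := hform_real u (hermsymB HH' HH).
rewrite scale1r ltrNl; apply: le_lt_trans (real_ler_norm _) _; first by rewrite rpredN.
rewrite normrN; apply: (@le_lt_trans _ _ (n%:R * e * nsq u)).
  by apply: hform_bound => i j; rewrite !mxE He.
rewrite ltr_pM2r ?nsq_gt0 // -[ltRHS]mul1r ltr_pdivlMr //.
by rewrite ltr_wpDl ?ltr01 // mulr_ge0.
Qed.
End HermitianForms.

(** * Evaluation of Laurent polynomials *)

Lemma polyO_horner (p : {poly int}) :
  polyO p = \val ((map_poly intr p).[tL] : Lambda).
Proof.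
elim/poly_ind: p => [|p c IHp].
  by rewrite !rmorph0 horner0 rmorph0 /polyO rmorph0 tofrac0.
rewrite rmorphD rmorphM /= map_polyX map_polyC hornerMXaddC polyOD polyOM IHp.
rewrite -[RHS]/(\val _) [RHS]rmorphD [X in _ = X + _]rmorphM -['X]expr1 polyOX expr1.
by congr (_ + _); rewrite [RHS]rmorph_int /polyO map_polyC /= !rmorph_int.
Qed.

Lemma Lambda_frac_horner (x : Lambda) :
  exists (p : {poly int}) (n : nat), x = tLV ^+ n * (map_poly intr p).[tL].
Proof.
have [[p n] /= px] := Lambda_fracP x; exists p, n; apply: val_inj.
rewrite [LHS]px polyO_horner -[RHS]/(\val _) [RHS]rmorphM [X in _ = X * _]rmorphXn /=.
by rewrite exprVn.
Qed.

Lemma Lambda_ind (P : Lambda -> Prop) :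
  (forall c : int, P c%:~R) -> P tL -> P tLV ->
  (forall x y, P x -> P y -> P (x + y)) -> (forall x y, P x -> P y -> P (x * y)) ->
  forall x, P x.
Proof.
move=> Pint Pt PtV PD PM x; have [p [n ->]] := Lambda_frac_horner x.
apply: (PM).
  elim: n => [|n IHn]; first by rewrite expr0; apply: (Pint 1).
  by rewrite exprS; apply: PM.
elim/poly_ind: p => [|p c IHp]; first by rewrite rmorph0 horner0; apply: (Pint 0).
rewrite rmorphD rmorphM /= map_polyX map_polyC hornerMXaddC.
by apply: (PD); [apply: PM|apply: Pint].
Qed.

Lemma Lambda_morph_ext (S : comNzRingType) (f g : {rmorphism Lambda -> S}) :
  f tL = g tL -> f =1 g.
Proof.
move=> fg; elim/Lambda_ind => [c||||].
- by rewrite !rmorph_int.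
- exact: fg.
- have fV := congr1 f tLK; have gV := congr1 g tLK.
  rewrite !rmorphM rmorph1 /= in fV; rewrite !rmorphM rmorph1 /= in gV.
  by rewrite -[LHS]mul1r -gV -fg mulrAC fV mul1r.
- by move=> x y fx fy; rewrite !rmorphD fx fy.
- by move=> x y fx fy; rewrite !rmorphM fx fy.
Qed.

(** A subtype, so that [circle_eval w] is a ring morphism for every [w] and bounds can be uniform in
    [w]. *)
Definition circle := {z : algC | `|z| == 1}.

Lemma circle_norm (w : circle) : `|val w| = 1. Proof. exact/eqP/(valP w). Qed.

Lemma circle_neq0 (w : circle) : val w != 0.
Proof. by rewrite -normr_eq0 circle_norm oner_eq0. Qed.

Lemma circle_inv (w : circle) : (val w)^-1 = (val w)^*.
Proof. by rewrite invC_norm circle_norm expr1n invr1 mul1r. Qed.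

Definition circle_eval (w : circle) : Lambda -> algC := laurent_eval (val w) (val w)^-1.

HB.instance Definition _ (w : circle) := GRing.isZmodMorphism.Build Lambda algC
  (circle_eval w) (laurent_eval_zmod (mulfV (circle_neq0 w))).
HB.instance Definition _ (w : circle) := GRing.isMonoidMorphism.Build Lambda algC
  (circle_eval w) (laurent_eval_monoid (mulfV (circle_neq0 w))).

Lemma laurent_eval_t (S : comNzRingType) (u v : S) : u * v = 1 -> laurent_eval u v tL = u.
Proof. by move=> uv; rewrite (laurent_evalE uv tL_frac) map_polyX hornerX mul1r. Qed.

Lemma circle_eval_t (w : circle) : circle_eval w tL = val w.
Proof. by rewrite /circle_eval laurent_eval_t // mulfV // circle_neq0. Qed.

Lemma circle_eval_tV (w : circle) : circle_eval w tLV = (val w)^*.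
Proof.
apply: (mulfI (circle_neq0 w)); rewrite -{1}(circle_eval_t w) -rmorphM /= tLK rmorph1.
by rewrite -circle_inv mulfV // circle_neq0.
Qed.

Lemma circle_eval_conj (w : circle) x : (circle_eval w x)^* = circle_eval w (Lambda_conj x).
Proof.
apply: (Lambda_morph_ext (f := Num.conj \o circle_eval w) (g := circle_eval w \o Lambda_conj)).
by rewrite /= Lambda_conj_t circle_eval_t circle_eval_tV.
Qed.

Lemma circle_eval_bound x : exists2 C : algC, 0 <= C & forall w, `|circle_eval w x| <= C.
Proof.
elim/Lambda_ind: x => [c||| x y [C C0 Cx] [C' C0' Cy] | x y [C C0 Cx] [C' C0' Cy]].
- by exists `|c%:~R| => // w; rewrite rmorph_int.
- by exists 1 => // w; rewrite circle_eval_t circle_norm.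
- by exists 1 => // w; rewrite circle_eval_tV norm_conjC circle_norm.
- exists (C + C') => [|w]; first exact: addr_ge0.
  by rewrite rmorphD (le_trans (ler_normD _ _)) // lerD ?Cx ?Cy.
- exists (C * C') => [|w]; first exact: mulr_ge0.
  by rewrite rmorphM normrM ler_pM ?Cx ?Cy.
Qed.

Lemma circle_eval_lip x : exists2 C : algC, 0 <= C &
  forall w w', `|circle_eval w x - circle_eval w' x| <= C * `|val w - val w'|.
Proof.
elim/Lambda_ind: x => [c||| x y [C C0 Cx] [C' C0' Cy] | x y [C C0 Cx] [C' C0' Cy]].
- by exists 0 => // w w'; rewrite !rmorph_int subrr normr0 mul0r.
- by exists 1 => // w w'; rewrite !circle_eval_t mul1r.
- by exists 1 => // w w'; rewrite !circle_eval_tV mul1r -rmorphB norm_conjC.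
- exists (C + C') => [|w w']; first exact: addr_ge0.
  rewrite !rmorphD /= opprD addrACA (le_trans (ler_normD _ _)) // mulrDl.
  by rewrite lerD ?Cx ?Cy.
- have [B B0 xB] := circle_eval_bound x; have [B' B0' yB] := circle_eval_bound y.
  exists (C * B' + B * C') => [|w w']; first by rewrite addr_ge0 // mulr_ge0.
  rewrite !rmorphM /=.
  move: (Cx w w') (Cy w w') (xB w') (yB w).
  move: (circle_eval w x) (circle_eval w' x) (circle_eval w y) (circle_eval w' y).
  move=> a a' b b' aa' bb' a'B bB.
  have -> : a * b - a' * b' = (a - a') * b + a' * (b - b') by ring.
  rewrite (le_trans (ler_normD _ _)) // !normrM mulrDl lerD //.
    by rewrite mulrAC ler_pM.
  by rewrite -mulrA ler_pM.
Qed.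

(** * Congruences between the values at 1 and -1 *)

Definition Lambda_atN1 : Lambda -> int := laurent_eval (-1) (-1).

Fact N1N1 : (-1) * (-1) = 1 :> int. Proof. by []. Qed.

HB.instance Definition _ := GRing.isZmodMorphism.Build Lambda int
  Lambda_atN1 (laurent_eval_zmod N1N1).
HB.instance Definition _ := GRing.isMonoidMorphism.Build Lambda int
  Lambda_atN1 (laurent_eval_monoid N1N1).

Lemma Lambda_atN1_t : Lambda_atN1 tL = -1.
Proof. by rewrite /Lambda_atN1 laurent_eval_t. Qed.

Lemma circle_eval_at1 (w : circle) x : val w = 1 -> circle_eval w x = (Lambda_at1 x)%:~R.
Proof.
move=> w1; apply: (Lambda_morph_ext (f := circle_eval w) (g := intr \o Lambda_at1)).
by rewrite /= circle_eval_t Lambda_at1_t w1.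
Qed.

Lemma circle_eval_atN1 (w : circle) x : val w = -1 -> circle_eval w x = (Lambda_atN1 x)%:~R.
Proof.
move=> w1; apply: (Lambda_morph_ext (f := circle_eval w) (g := intr \o Lambda_atN1)).
by rewrite /= circle_eval_t Lambda_atN1_t w1.
Qed.

Lemma Lambda_atN1_conj x : Lambda_atN1 (Lambda_conj x) = Lambda_atN1 x.
Proof.
apply: (Lambda_morph_ext (f := Lambda_atN1 \o Lambda_conj) (g := Lambda_atN1)).
have := congr1 Lambda_atN1 tLK; rewrite rmorphM rmorph1 /= Lambda_conj_t Lambda_atN1_t.
by rewrite mulN1r => /eqP; rewrite eqr_oppLR => /eqP.
Qed.

Lemma Lambda_at1_conj x : Lambda_at1 (Lambda_conj x) = Lambda_at1 x.
Proof.
apply: (Lambda_morph_ext (f := Lambda_at1 \o Lambda_conj) (g := Lambda_at1)).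
have := congr1 Lambda_at1 tLK; rewrite rmorphM rmorph1 /= Lambda_conj_t Lambda_at1_t.
by rewrite mul1r.
Qed.

Lemma Lambda_at_mod2 x : exists c : int, Lambda_atN1 x = Lambda_at1 x + 2 * c.
Proof.
elim/Lambda_ind: x => [c||| x y [a xa] [b yb] | x y [a xa] [b yb]].
- by exists 0; rewrite !rmorph_int; ring.
- by exists (-1); rewrite Lambda_atN1_t Lambda_at1_t.
- by exists (-1); rewrite -Lambda_conj_t Lambda_atN1_conj Lambda_at1_conj Lambda_atN1_t Lambda_at1_t.
- by exists (a + b); rewrite !rmorphD /= xa yb; ring.
- exists (Lambda_at1 x * b + a * Lambda_at1 y + 2 * a * b).
  by rewrite !rmorphM /= xa yb; ring.
Qed.

Lemma horner_tL_inj (p q : {poly int}) :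
  (map_poly intr p).[tL] = (map_poly intr q).[tL] :> Lambda -> p = q.
Proof. by move=> pq; apply: polyO_inj; rewrite !polyO_horner pq. Qed.

(** Taylor expansion at 1 with increment -2: from the quadratic term on, everything is divisible by
    4. *)
Lemma horner_N1_mod4 (p : {poly int}) :
  exists c : int, p.[-1] = p.[1] - 2 * p^`().[1] + 4 * c.
Proof.
elim/poly_ind: p => [|p a [c pE]]; first by exists 0; rewrite deriv0 !horner0.
exists (p^`().[1] - c); rewrite derivMXaddC hornerD hornerMX !hornerMXaddC pE.
by ring.
Qed.

(* If [x = t^-n p(t)] is symmetric then [t^(2n) p(1/t) = p(t)]; differentiating
   at [1] gives [p'(1) = n p(1)]. *)
Lemma Lambda_at_mod4 x : Lambda_conj x = x ->
  exists c : int, Lambda_atN1 x = Lambda_at1 x + 4 * c.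
Proof.
have [p [n ->]] := Lambda_frac_horner x.
have mor (S : comNzRingType) (f : {rmorphism Lambda -> S}) :
    f (map_poly intr p).[tL] = (map_poly intr p).[f tL].
  rewrite -horner_map /= -map_poly_comp; congr (_.[_]).
  by apply: eq_map_poly => c /=; rewrite rmorph_int.
have atN1V : Lambda_atN1 tLV = -1.
  by rewrite -Lambda_conj_t Lambda_atN1_conj Lambda_atN1_t.
have at1V : Lambda_at1 tLV = 1.
  by rewrite -Lambda_conj_t Lambda_at1_conj Lambda_at1_t.
have conjV : Lambda_conj tLV = tL by rewrite -Lambda_conj_t Lambda_conjK.
have intp : map_poly intr p = p :> {poly int}.
  by apply: map_poly_id => c _; rewrite intz.
rewrite !rmorphM !rmorphXn /= !mor /=.
rewrite Lambda_conj_t Lambda_atN1_t Lambda_at1_t atN1V at1V conjV intp expr1n mul1r.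
(* [q] is t^N p(1/t). For nonzero [p], [N] is one more than the degree; the surplus factor t occurs
   on both sides of [qE] and cancels in the derivative at 1. *)
move=> symx; pose N := size p.
pose q := \sum_(i < N) p`_i *: 'X^(N - i).
have qE : 'X^(n + n) * q = 'X^N * p.
  apply: horner_tL_inj; rewrite !rmorphM /= !map_polyXn !hornerM !hornerXn.
  have -> : (map_poly intr q).[tL] = tL ^+ N * (map_poly intr p).[tLV].
    rewrite /q rmorph_sum /= horner_sum horner_coef size_map_inj_poly //; last first.
      by move=> a b /(congr1 Lambda_at1); rewrite !rmorph_int !intz.
    rewrite mulr_sumr; apply: eq_bigr => i _.
    rewrite linearZ /= map_polyXn hornerZ hornerXn coef_map /=.
    have -> : tL ^+ N = tL ^+ (N - i) * tL ^+ i by rewrite -exprD subnK // ltnW.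
    have /esym tiV : tL ^+ i * tLV ^+ i = 1 by rewrite -exprMn tLK expr1n.
    by rewrite -[LHS]mul1r tiV; ring.
  have -> : (map_poly intr p).[tL] = tL ^+ n * (tLV ^+ n * (map_poly intr p).[tL]).
    by rewrite mulrA -exprMn tLK expr1n mul1r.
  by rewrite -symx exprD; ring.
have q1 : q.[1] = p.[1].
  rewrite /q horner_sum horner_coef; apply: eq_bigr => i _.
  by rewrite hornerZ hornerXn !expr1n.
have dq1 : q^`().[1] = N%:R * p.[1] - p^`().[1].
  have -> : p^`().[1] = \sum_(i < N) p`_i *+ i.
    rewrite -[in LHS](coefK p) poly_def linear_sum horner_sum; apply: eq_bigr => i _.
    by rewrite linearZ /= hornerZ derivXn hornerMn hornerXn expr1n mulrnAr mulr1.
  rewrite /q linear_sum horner_sum horner_coef mulr_sumr -sumrB; apply: eq_bigr => i _.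
  rewrite linearZ /= hornerZ derivXn hornerMn hornerXn !expr1n mulr1 mulrnAr mulr1.
  by rewrite mulrnBr ?(ltnW (ltn_ord i)) // mulr_natl.
have := congr1 (fun r : {poly int} => r^`().[1]) qE.
rewrite /= !derivM !derivXn !hornerD !hornerM !hornerMn !hornerXn !expr1n !mul1r.
rewrite q1 dq1 => dE.
have {}dE : p^`().[1] = n%:R * p.[1].
  move/eqP: dE; rewrite -subr_eq0 !natrD => /eqP dE.
  apply: (mulfI (_ : 2 != 0 :> int)) => //.
  rewrite -[LHS]addr0 -dE; ring.
have [c pE] := horner_N1_mod4 p; rewrite pE dE.
(* For even n, 2n is divisible by 4; for odd n the left side is 2n - 1, again 1 modulo 4. *)
have [d dE'] : exists d : int, (-1) ^+ n * (1 - 2 * n%:R) = 1 + 4 * d :> int.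
  elim: n {dE qE symx} => [|n [d dE]]; first by exists 0.
  have signE : (-1) ^+ n = 1 :> int \/ (-1) ^+ n = -1 :> int.
    by rewrite -signr_odd; case: (odd n); rewrite ?expr0 ?expr1; [right|left].
  rewrite exprS -[n.+1%:R]natr1; case: signE dE => ->; move: (n%:R : int) => m dE.
    by exists (- d); lia.
  by exists (- d - 1); lia.
exists (p.[1] * d + (-1) ^+ n * c).
transitivity ((-1) ^+ n * (1 - 2 * n%:R) * p.[1] + 4 * ((-1) ^+ n * c)); first by ring.
by rewrite dE'; ring.
Qed.

(** * Presentations of isomorphic cokernels *)

Section CokernelMaps.
Variable R : comNzRingType.

Definition coker_pi n (A : 'M[R]_n) (v : 'cV[R]_n) : coker A := \pi_(coker A) v.

Fact coker_pi_linear n (A : 'M[R]_n) : linear (coker_pi A).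
Proof. by move=> a v w; rewrite /coker_pi coker_piD coker_piZ. Qed.

HB.instance Definition _ n (A : 'M[R]_n) := GRing.isLinear.Build R _ _ _ _ (coker_pi_linear A).

Lemma col_expand m (v : 'cV[R]_m) : v = \sum_j v j 0 *: delta_mx j 0.
Proof. by rewrite {1}[v]matrix_sum_delta; apply: eq_bigr => i _; rewrite big_ord1. Qed.

Lemma colspace_choice m p (D : 'M[R]_m) (M : 'M[R]_(m, p)) :
  (forall j, exists x, col j M = D *m x) -> exists X, M = D *m X.
Proof.
move=> /choice[x xE]; exists (\matrix_(i, j) x j i 0).
apply/matrixP => i j; have := congr1 (fun c : 'cV_m => c i 0) (xE j).
by rewrite !mxE => ->; apply: eq_bigr => l _; rewrite !mxE.
Qed.

Lemma coker_pi_eq0 n (A : 'M[R]_n) v : coker_pi A v = 0 <-> exists x, v = A *m x.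
Proof.
rewrite -(raddf0 (coker_pi A)) /coker_pi coker_eq.
by split=> -[x E]; exists x; rewrite ?subr0 // -E subr0.
Qed.

Lemma coker_pi_repr n (A : 'M[R]_n) (x : coker A) : coker_pi A (repr x) = x.
Proof. exact: reprK. Qed.

(** [F] and [F'] lift the isomorphism and its inverse to the generators, [G] and [G'] are the
    induced maps of relations, [Y] and [Z] are homotopies: an equivalence of the two-term complexes
    given by [A] and [D]. *)
Lemma coker_iso_matrices n m (A : 'M[R]_n) (D : 'M[R]_m)
    (f : {linear coker A -> coker D}) : bijective f ->
  exists (F : 'M[R]_(m, n)) (F' : 'M[R]_(n, m)),
    (forall v, f (coker_pi A v) = coker_pi D (F *m v)) /\
    exists G G' Y Z, [/\ F *m A = D *m G, F' *m D = A *m G',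
      F' *m F = 1%:M + A *m Y & F *m F' = 1%:M + D *m Z].
Proof.
case=> g gK fK.
pose F : 'M[R]_(m, n) := \matrix_(i, j) repr (f (coker_pi A (delta_mx j 0))) i 0.
pose F' : 'M[R]_(n, m) := \matrix_(i, j) repr (g (coker_pi D (delta_mx j 0))) i 0.
have FE v : f (coker_pi A v) = coker_pi D (F *m v).
  rewrite [v]col_expand mulmx_sumr !linear_sum; apply: eq_bigr => j _.
  rewrite -scalemxAr !linearZ /=; congr (_ *: _).
  rewrite -[LHS]coker_pi_repr; congr coker_pi; rewrite -colE.
  by apply/colP => i; rewrite !mxE.
have F'E v : f (coker_pi A (F' *m v)) = coker_pi D v.
  rewrite [v in RHS]col_expand [v in LHS]col_expand mulmx_sumr !linear_sum.
  apply: eq_bigr => j _; rewrite -scalemxAr !linearZ /=; congr (_ *: _).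
  rewrite -[RHS]fK; congr (f _); rewrite -[RHS]coker_pi_repr; congr coker_pi.
  by rewrite -colE; apply/colP => i; rewrite !mxE.
exists F, F'; split=> //.
have f0 x : f x = 0 -> x = 0 by move=> fx; rewrite -[x]gK fx -[RHS]gK linear0.
have [G GE] : exists G, F *m A = D *m G.
  apply: colspace_choice => j; apply/coker_pi_eq0.
  rewrite colE -mulmxA -FE (_ : coker_pi A _ = 0) ?linear0 //.
  by apply/coker_pi_eq0; exists (delta_mx j 0).
have [G' G'E] : exists G', F' *m D = A *m G'.
  apply: colspace_choice => j; apply/coker_pi_eq0/f0.
  by rewrite colE -mulmxA F'E; apply/coker_pi_eq0; exists (delta_mx j 0).
have [Y YE] : exists Y, F' *m F - 1%:M = A *m Y.
  apply: colspace_choice => j; apply/coker_pi_eq0/f0.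
  by rewrite colE mulmxBl -mulmxA mul1mx linearB /= linearB /= F'E FE subrr.
have [Z ZE] : exists Z, F *m F' - 1%:M = D *m Z.
  apply: colspace_choice => j; apply/coker_pi_eq0.
  by rewrite colE mulmxBl -mulmxA mul1mx linearB /= -FE F'E subrr.
by exists G, G', Y, Z; rewrite -YE -ZE ![1%:M + _]addrC !subrK.
Qed.

Section FromMatrices.
Variables (n m : nat) (A : 'M[R]_n) (D : 'M[R]_m).
Variables (F G : 'M[R]_(m, n)) (F' G' : 'M[R]_(n, m)) (Y : 'M[R]_n) (Z : 'M[R]_m).
Hypotheses (FA : F *m A = D *m G) (F'D : F' *m D = A *m G').
Hypotheses (F'F : F' *m F = 1%:M + A *m Y) (FF' : F *m F' = 1%:M + D *m Z).

(** [A] and [D] may differ in size. [P1] and [P2] have the determinants of [D] and [A] but a common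
    size, and each is a right multiple of the other by an explicit block matrix. *)
Lemma det_dvd_coker : exists u u', \det A = \det D * u /\ \det D = \det A * u'.
Proof.
pose P1 : 'M_(n + m) := block_mx 1%:M 0 (- F) D.
pose P2 : 'M_(n + m) := block_mx A (- F') 0 1%:M.
have detP1 : \det P1 = \det D by rewrite det_lblock det1 mul1r.
have detP2 : \det P2 = \det A by rewrite det_ublock det1 mulr1.
exists (\det (block_mx A (- F') G (- Z))), (\det (block_mx (- Y) G' (- F) D)).
rewrite -detP1 -detP2 -!det_mulmx !mulmx_block.
rewrite !(mul1mx, mul0mx, addr0, add0r, mulNmx, mulmxN, opprK) -FA addNr FF' addrK.
by rewrite F'F addrCA addNr addr0 F'D subrr.
Qed.

Definition coker_map (x : coker A) : coker D := coker_pi D (F *m repr x).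

Lemma coker_map_pi v : coker_map (coker_pi A v) = coker_pi D (F *m v).
Proof.
apply/eqP; rewrite -subr_eq0 /coker_map -linearB /= -mulmxBr; apply/eqP/coker_pi_eq0.
have /coker_pi_eq0[x ->] : coker_pi A (repr (coker_pi A v) - v) = 0.
  by rewrite linearB /= coker_pi_repr subrr.
by exists (G *m x); rewrite [LHS]mulmxA FA -mulmxA.
Qed.

Fact coker_map_linear : linear coker_map.
Proof.
move=> a x y; rewrite -[x]coker_pi_repr -[y]coker_pi_repr -linearP !coker_map_pi.
by rewrite mulmxDr -scalemxAr linearP.
Qed.
End FromMatrices.

Lemma coker_iso_of_matrices n m (A : 'M[R]_n) (D : 'M[R]_m) F G F' G' Y Z :
  F *m A = D *m G -> F' *m D = A *m G' ->
  F' *m F = 1%:M + A *m Y -> F *m F' = 1%:M + D *m Z ->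
  exists2 f : {linear coker A -> coker D}, bijective f &
    forall v, f (coker_pi A v) = coker_pi D (F *m v).
Proof.
move=> FA F'D F'F FF'.
pose fL := GRing.isLinear.Build R _ _ _ _ (coker_map_linear FA).
pose f : {linear coker A -> coker D} := HB.pack (@coker_map _ _ A D F) fL.
exists f; last exact: coker_map_pi FA.
exists (@coker_map _ _ D A F') => x; rewrite -[x]coker_pi_repr.
  rewrite [f _](coker_map_pi FA) (coker_map_pi F'D) mulmxA F'F mulmxDl mul1mx linearD /=.
  rewrite [X in _ + X](_ : _ = 0) ?addr0 //; apply/coker_pi_eq0.
  by exists (Y *m repr x); rewrite mulmxA.
rewrite (coker_map_pi F'D) [f _](coker_map_pi FA) mulmxA FF' mulmxDl mul1mx linearD /=.
rewrite [X in _ + X](_ : _ = 0) ?addr0 //; apply/coker_pi_eq0.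
by exists (Z *m repr x); rewrite mulmxA.
Qed.
End CokernelMaps.

Definition Lambda_adj m n (F : 'M[Lambda]_(m, n)) : 'M[Lambda]_(n, m) := (map_mx Lambda_conj F)^T.

Local Notation OM := (map_mx (val : Lambda -> Omega)).

Lemma map_mx_injective (S T : Type) (f : S -> T) m n :
  injective f -> injective (map_mx f : 'M_(m, n) -> 'M_(m, n)).
Proof.
move=> fI A B /matrixP AB; apply/matrixP => i j.
by have := AB i j; rewrite !mxE => /fI.
Qed.

Lemma Lambda_mx_unit n (A : 'M[Lambda]_n) : \det A != 0 -> OM A \in unitmx.
Proof. by move=> dA; rewrite unitmxE det_map_mx unitfE Lambda_val_eq0. Qed.

Lemma mxform_delta (S : comNzRingType) (m n p q : nat) (P : 'M[S]_(p, m))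
    (B : 'M[S]_(p, q)) (Q : 'M[S]_(q, n)) i j :
  ((P *m delta_mx i (0 : 'I_1))^T *m B *m (Q *m delta_mx j (0 : 'I_1))) 0 0 = (P^T *m B *m Q) i j.
Proof. by rewrite trmx_mul trmx_delta !mulmxA -colE mxE -!mulmxA -rowE mxE !mulmxA. Qed.

(** Tested on basis vectors, the isometry says that (t - 1) F^* D^-1 F - A^-1 is a matrix [X] over
    [Lambda], where F^* is [Lambda_adj F]. Multiplication by [A] from the right removes the
    inverses, since [F *m A = D *m G]. *)
Lemma blanchfield_matrices k (V : 'M[int]_(2 * k)) n (A : 'M[Lambda]_n) :
  seifert_matrix V -> hermitian_mx A -> \det A != 0 ->
  isometric (lambda_mx (A := A)) (blanchfield (V := V)) ->
  let D := alexander_mx V in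
  exists F F' G G' Y Z X,
    [/\ F *m A = D *m G, F' *m D = A *m G',
      F' *m F = 1%:M + A *m Y, F *m F' = 1%:M + D *m Z &
      (tL - 1) *: (Lambda_adj F *m G) = 1%:M + X *m A].
Proof.
move=> hV hA dA [f [fbij fiso]] D.
have [F [F' [FE [G [G' [Y [Z [FA F'D F'F FF']]]]]]]] := coker_iso_matrices fbij.
exists F, F', G, G', Y, Z.
pose B := (tO - 1) *: invmx (OM D); pose Ai := invmx (OM A).
have XE i j : exists r : Lambda, ((OM (Lambda_adj F) *m B *m OM F) i j - Ai i j) = val r.
  have := fiso (coker_pi A (delta_mx i 0)) (coker_pi A (delta_mx j 0)).
  rewrite !FE /coker_pi lambda_mx_pi // blanchfield_pi // => /quot_field_eq[r rE].
  exists r; rewrite -[RHS]rE !map_mxM !map_delta_mx mxform_delta map_trmx.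
  congr (_ - _); have := mxform_delta 1%:M Ai 1%:M i j.
  by rewrite trmx1 !mul1mx mulmx1 => ->.
have [X XE'] : exists X : 'M_n, OM (Lambda_adj F) *m B *m OM F - Ai = OM X.
  have /choice[X XE'] : forall i, exists r : 'I_n -> Lambda,
      forall j, (OM (Lambda_adj F) *m B *m OM F) i j - Ai i j = val (r j).
    by move=> i; have [r rE] := choice (XE i); exists r.
  by exists (\matrix_(i, j) X i j); apply/matrixP => i j; rewrite [RHS]mxE mxE -XE' !mxE.
exists X; split=> //; apply: (map_mx_injective val_inj).
have uD : OM D \in unitmx := alexander_mx_unit hV.
have FA' : OM F *m OM A = OM D *m OM G by rewrite -!map_mxM FA.
rewrite map_mxD map_mxM map_mx1 -XE' mulmxBl -[_ *m _ *m OM A]mulmxA FA'.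
rewrite mulVmx ?Lambda_mx_unit // [RHS]addrC subrK.
by rewrite map_mxZ map_mxM rmorphB rmorph1 /= /B -!scalemxAr -!scalemxAl -!mulmxA mulKmx.
Qed.

(** * The glued hermitian form *)

Lemma Lambda_adjM m n p (P : 'M_(m, n)) (Q : 'M_(n, p)) :
  Lambda_adj (P *m Q) = Lambda_adj Q *m Lambda_adj P.
Proof. by rewrite /Lambda_adj map_mxM trmx_mul. Qed.

Lemma Lambda_adjK m n (P : 'M_(m, n)) : Lambda_adj (Lambda_adj P) = P.
Proof. by apply/matrixP => i j; rewrite !mxE Lambda_conjK. Qed.

Lemma Lambda_adjD m n (P Q : 'M_(m, n)) : Lambda_adj (P + Q) = Lambda_adj P + Lambda_adj Q.
Proof. by rewrite /Lambda_adj map_mxD linearD. Qed.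

Lemma Lambda_adjN m n (P : 'M_(m, n)) : Lambda_adj (- P) = - Lambda_adj P.
Proof. by rewrite /Lambda_adj map_mxN linearN. Qed.

Lemma Lambda_adjB m n (P Q : 'M_(m, n)) : Lambda_adj (P - Q) = Lambda_adj P - Lambda_adj Q.
Proof. by rewrite Lambda_adjD Lambda_adjN. Qed.

Lemma Lambda_adjZ m n a (P : 'M_(m, n)) : Lambda_adj (a *: P) = Lambda_conj a *: Lambda_adj P.
Proof. by rewrite /Lambda_adj map_mxZ linearZ. Qed.

Lemma Lambda_adj1 n : Lambda_adj (1%:M : 'M_n) = 1%:M.
Proof. by rewrite /Lambda_adj map_mx1 trmx1. Qed.

Lemma Lambda_adj0 m n : Lambda_adj (0 : 'M_(m, n)) = 0.
Proof. by rewrite /Lambda_adj map_mx0 trmx0. Qed.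

Lemma Lambda_adj_block m1 m2 n1 n2 (P : 'M_(m1, n1)) (Q : 'M_(m1, n2)) (R : 'M_(m2, n1)) (S : 'M_(m2, n2)) :
  Lambda_adj (block_mx P Q R S) =
  block_mx (Lambda_adj P) (Lambda_adj R) (Lambda_adj Q) (Lambda_adj S).
Proof. by rewrite /Lambda_adj map_block_mx tr_block_mx. Qed.

Lemma Lambda_conj_tV : Lambda_conj tLV = tL.
Proof. by rewrite -Lambda_conj_t Lambda_conjK. Qed.

Lemma Lambda_adj_alexander k (V : 'M[int]_(2 * k)) :
  Lambda_adj (alexander_mx V) = - tLV *: alexander_mx V.
Proof.
apply/matrixP => i j; rewrite !mxE rmorphB rmorphM /= Lambda_conj_t.
rewrite !rmorph_int; move: (V j i)%:~R (V i j)%:~R => p q.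
by rewrite -[q in LHS]mul1r -tLVK; ring.
Qed.

(* Up to sign, the inverse of Kearton's pairing made hermitian over Lambda. *)
Definition hermitian_alexander k (V : 'M[int]_(2 * k)) : 'M[Lambda]_(2 * k) :=
  (1 - tLV) *: alexander_mx V.

Lemma hermitian_alexanderE k (V : 'M[int]_(2 * k)) : hermitian_mx (hermitian_alexander V).
Proof.
rewrite /hermitian_mx -/(Lambda_adj _) Lambda_adjZ Lambda_adj_alexander scalerA.
congr (_ *: _); rewrite rmorphB rmorph1 /= Lambda_conj_tV.
by rewrite -[X in _ = X - _]tLK; ring.
Qed.

Lemma Lambda_mulfI (a x y : Lambda) : a != 0 -> a * x = a * y -> x = y.
Proof.
move=> a0 axy; apply: val_inj; apply: (mulfI (_ : val a != 0)).
  by rewrite Lambda_val_eq0.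
by rewrite -!(rmorphM (val : {rmorphism Lambda -> Omega})) axy.
Qed.

Lemma Lambda_mxI n m (A : 'M[Lambda]_n) (P Q : 'M[Lambda]_(n, m)) :
  \det A != 0 -> A *m P = A *m Q -> P = Q.
Proof.
move=> dA AP; have := congr1 (mulmx (\adj A)) AP; rewrite !mulmxA mul_adj_mx.
rewrite !mul_scalar_mx => /matrixP PQ; apply/matrixP => i j.
by have := PQ i j; rewrite !mxE; apply: Lambda_mulfI.
Qed.

(* The form [Gm] lives on the overlattice glued along the isometry of the two
   cokernels; it is unimodular away from [t = 1], and [W] includes the
   lattice of the orthogonal sum in it. *)
Lemma glued_form k (V : 'M[int]_(2 * k)) n (A : 'M[Lambda]_n) :
  seifert_matrix V -> hermitian_mx A -> \det A != 0 ->
  isometric (lambda_mx (A := A)) (blanchfield (V := V)) ->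
  exists Gm K W : 'M[Lambda]_(n + 2 * k),
    [/\ hermitian_mx Gm,
      Lambda_adj W *m Gm *m W = block_mx A 0 0 (hermitian_alexander V) &
      Gm *m K = ((1 - tLV) ^+ (2 * k))%:M].
Proof.
move=> hV hA dA /(blanchfield_matrices hV hA dA)[F [F' [G [G' [Y [Z [X]]]]]]].
case=> FA F'D F'F FF' XA; set D := alexander_mx V in FA F'D FF'.
set N := hermitian_alexander V.
have hN : Lambda_adj N = N := hermitian_alexanderE V.
have {}hA : Lambda_adj A = A := hA.
have AF : A *m Lambda_adj F = - tLV *: (Lambda_adj G *m D).
  by rewrite -[A in LHS]hA -Lambda_adjM FA Lambda_adjM Lambda_adj_alexander scalemxAr.
have tN : (tL - 1) * - tLV = - (1 - tLV).
  by rewrite -[X in _ = - (X - _)]tLK; ring.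
have AXA : A *m (X *m A) = - (Lambda_adj G *m N *m G) - A.
  rewrite -[X *m A](addKr 1%:M) -XA mulmxDr mulmxN mulmx1 addrC -scalemxAr mulmxA AF.
  by rewrite -scalemxAl scalerA tN /N /hermitian_alexander -scalemxAr -scalemxAl scaleNr.
(* [AXA] shows that the product A X A is hermitian, and [A] cancels on both sides. *)
have hX : Lambda_adj X = X.
  apply: (Lambda_mxI dA); rewrite -[LHS]Lambda_adjK -[RHS]Lambda_adjK; congr Lambda_adj.
  rewrite !Lambda_adjM hA Lambda_adjK; apply: (Lambda_mxI dA).
  have -> : A *m (Lambda_adj X *m A) = Lambda_adj (A *m (X *m A)).
    by rewrite !Lambda_adjM hA mulmxA.
  rewrite AXA Lambda_adjB Lambda_adjN !Lambda_adjM Lambda_adjK hN hA.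
  by rewrite mulmxA.
(* Over [Omega] the columns of W^-1 are the vectors (A^-1 e, D^-1 F e), the graph of the isometry,
   and the basis of the second summand. [Gm] is the form of the orthogonal sum of [A] and [N] in
   this basis; its first block A^-1 - (t - 1) F^* D^-1 F equals -X and is thus integral. *)
pose Gm := block_mx (- X) (- (tL - 1) *: Lambda_adj F) ((1 - tLV) *: F) N.
pose W := block_mx A 0 (- G) (1%:M : 'M_(2 * k)).
have [u [u' [uE u'E]]] := det_dvd_coker FA F'D F'F FF'.
have hGm : hermitian_mx Gm.
  rewrite /hermitian_mx -/(Lambda_adj Gm) /Gm Lambda_adj_block hN Lambda_adjN hX !Lambda_adjZ.
  rewrite Lambda_adjK; congr block_mx; congr (_ *: _); rewrite !(rmorphN, rmorphB, rmorph1) /=.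
    by rewrite Lambda_conj_tV; ring.
  by rewrite Lambda_conj_t; ring.
have ur0 : A *m (- (tL - 1) *: Lambda_adj F) + - Lambda_adj G *m N = 0.
  rewrite -scalemxAr AF scalerA (_ : - (tL - 1) * - tLV = 1 - tLV); last first.
    by rewrite -[X in _ = X - _]tLK; ring.
  by rewrite mulNmx /N /hermitian_alexander -scalemxAr -/D addrN.
have NG : (1 - tLV) *: F *m A = N *m G.
  by rewrite -scalemxAl FA /N /hermitian_alexander -/D -scalemxAl.
have WGmW : Lambda_adj W *m Gm *m W = block_mx A 0 0 N.
  rewrite /W Lambda_adj_block hA !Lambda_adj0 Lambda_adj1 Lambda_adjN !mulmx_block.
  rewrite !(mulmx0, mul0mx, mulmx1, mul1mx, add0r, addr0) ur0 mul0mx addr0.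
  rewrite NG [N *m - G]mulmxN addrN; congr block_mx.
  rewrite mulmxDl [A *m - X]mulmxN mulNmx -!mulmxA AXA NG.
  by rewrite opprB opprK mulNmx mulmxA addrK.
(* Gluing divides the determinant of the orthogonal sum by the square of [\det A]. One factor is
   that of [A], the other comes from [\det D = \det A * u']. *)
have dGm : \det Gm = (1 - tLV) ^+ (2 * k) * u'.
  have := congr1 determinant WGmW; rewrite !det_mulmx det_ublock /W Lambda_adj_block.
  rewrite hA Lambda_adj0 Lambda_adj1 det_ublock det_lblock !det1 !mulr1.
  rewrite /N /hermitian_alexander detZ -/D u'E -mulrA => /(Lambda_mulfI dA) E.
  by apply: (Lambda_mulfI dA); rewrite mulrC E; ring.
have uu' : u' * u = 1 by apply: (Lambda_mulfI dA); rewrite mulrA -u'E -uE mulr1.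
exists Gm, (u *: \adj Gm), W; split=> //.
by rewrite -scalemxAr mul_mx_adj dGm scale_scalar_mx mulrCA [u * u']mulrC uu' mulr1.
Qed.

(** * Signatures along the unit circle *)

Lemma finite_bound (I : finType) (P : I -> algC -> Prop) :
  (forall i C C', C <= C' -> P i C -> P i C') ->
  (forall i, exists2 C, 0 <= C & P i C) -> exists2 C, 0 <= C & forall i, P i C.
Proof.
move=> Pmono PE; have /choice[c cP] : forall i, exists C, 0 <= C /\ P i C.
  by move=> i; have [C C0 PC] := PE i; exists C.
have c0 i : 0 <= c i by case: (cP i).
exists (\sum_i c i); first by rewrite sumr_ge0.
move=> i; apply: (Pmono i (c i)); last by case: (cP i).
by rewrite (bigD1 i) //= lerDl sumr_ge0.
Qed.

Local Notation CE w := (map_mx (circle_eval w)).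

Lemma circle_mx_bound m n (B : 'M[Lambda]_(m, n)) :
  exists2 C : algC, 0 <= C & forall w i j, `|CE w B i j| <= C.
Proof.
have [|[i j]|C C0 BC] := @finite_bound ('I_m * 'I_n)%type
    (fun ij C => forall w, `|CE w B ij.1 ij.2| <= C).
- by move=> ij C C' CC' BC w; apply: le_trans CC'.
- by have [C C0 CB] := circle_eval_bound (B i j); exists C => // w; rewrite mxE.
- by exists C => // w i j; apply: (BC (i, j)).
Qed.

Lemma circle_mx_lip m n (B : 'M[Lambda]_(m, n)) :
  exists2 C : algC, 0 <= C &
    forall w w' i j, `|CE w B i j - CE w' B i j| <= C * `|val w - val w'|.
Proof.
have [|[i j]|C C0 BC] := @finite_bound ('I_m * 'I_n)%type
    (fun ij C => forall w w', `|CE w B ij.1 ij.2 - CE w' B ij.1 ij.2| <= C * `|val w - val w'|).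
- by move=> ij C C' CC' BC w w'; apply: le_trans (BC w w') _; rewrite ler_wpM2r.
- by have [C C0 CB] := circle_eval_lip (B i j); exists C => // w w'; rewrite !mxE.
- by exists C => // w w' i j; apply: (BC (i, j)).
Qed.

Lemma circle_mx_adj m n (B : 'M[Lambda]_(m, n)) w : CE w (Lambda_adj B) = (CE w B)^t*.
Proof. by apply/matrixP => i j; rewrite !mxE circle_eval_conj. Qed.

Lemma circle_mx_herm n (B : 'M[Lambda]_n) w : hermitian_mx B -> CE w B \is hermsymmx.
Proof.
move=> hB; apply/is_hermitianmxP; rewrite expr0 scale1r -circle_mx_adj.
by rewrite /Lambda_adj hB.
Qed.

Lemma cayley_neq0 (s : rat) : ratr s - 'i != 0 :> algC.
Proof.
apply/eqP => /(congr1 (fun z => 'Im z)); rewrite raddfB /= raddf0 Im_i.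
by rewrite (Creal_ImP _ (Creal_Crat (Crat_rat _))) sub0r => /eqP; rewrite oppr_eq0 oner_eq0.
Qed.

Fact cayley_conj (s : rat) : (ratr s - 'i)^* = ratr s + 'i :> algC.
Proof. by rewrite rmorphB /= fmorph_rat conjCi opprK. Qed.

Lemma cayley_norm (s : rat) : `|(ratr s + 'i) / (ratr s - 'i) : algC| == 1.
Proof.
by rewrite normf_div -cayley_conj norm_conjC divff // normr_eq0 cayley_neq0.
Qed.

(** The parameter 0 gives -1, and the points approach 1 as s grows. Rational parameters allow equal
    steps along the arc with explicit estimates. *)
Definition cayley (s : rat) : circle :=
  exist (fun z : algC => is_true (`|z| == 1)) _ (cayley_norm s).

Lemma cayleyE s : val (cayley s) = (ratr s + 'i) / (ratr s - 'i). Proof. by []. Qed.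

Lemma cayley0 : val (cayley 0) = -1.
Proof. by rewrite cayleyE rmorph0 add0r sub0r invrN mulrN divff // neq0Ci. Qed.

Lemma cayley_den_sqr (s : rat) : `|ratr s - 'i : algC| ^+ 2 = ratr s ^+ 2 + 1.
Proof. by rewrite normCK cayley_conj -subr_sqr sqrCi opprK. Qed.

Lemma cayley_den_ge1 (s : rat) : 1 <= `|ratr s - 'i : algC|.
Proof.
rewrite -(@expr_ge1 _ 2) // cayley_den_sqr lerDr real_exprn_even_ge0 //.
by rewrite Creal_Crat // Crat_rat.
Qed.

Lemma cayley_lip s s' : `|val (cayley s) - val (cayley s')| <= 2 * `|ratr s - ratr s' : algC|.
Proof.
have d0 := cayley_neq0 s; have d0' := cayley_neq0 s'.
have -> : val (cayley s) - val (cayley s') =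
    2 * 'i * (ratr s' - ratr s) / ((ratr s - 'i) * (ratr s' - 'i)).
  by rewrite !cayleyE; field; rewrite d0 d0'.
rewrite normf_div !normrM normCi mulr1 normr_nat [X in _ * X / _]distrC.
rewrite ler_pdivrMr ?mulr_gt0 ?normr_gt0 // ler_peMr ?mulr_ge0 //.
by rewrite -[leLHS]mulr1 ler_pM ?cayley_den_ge1.
Qed.

Lemma cayley_dist1 s : `|val (cayley s) - 1| = 2 / `|ratr s - 'i : algC|.
Proof.
have -> : val (cayley s) - 1 = 2 * 'i / (ratr s - 'i).
  by rewrite cayleyE; have := cayley_neq0 s => d0; field.
by rewrite normf_div normrM normCi mulr1 normr_nat.
Qed.

Lemma cayley_den_le (s : rat) : 0 <= s -> `|ratr s - 'i : algC| <= ratr s + 1.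
Proof.
move=> s0; apply: le_trans (ler_normB _ _) _.
by rewrite normCi lerD2r ger0_norm // ler0q.
Qed.

Lemma cayley_den_ge (s : rat) : 0 <= s -> ratr s <= `|ratr s - 'i : algC|.
Proof.
move=> s0; rewrite -(@ler_pXn2r _ 2) ?nnegrE ?ler0q // cayley_den_sqr.
by rewrite lerDl.
Qed.

(* Walk from [s = S] down to [s = 0] in steps so small that the bound on the
   inverse of [Gm] lets [pos_index_perturb] apply at each of them. *)
Lemma cayley_path n (Gm K : 'M[Lambda]_n) r p (S : nat) :
  hermitian_mx Gm -> Gm *m K = ((1 - tLV) ^+ r)%:M ->
  pos_index_ge (CE (cayley S%:R) Gm) p -> pos_index_ge (CE (cayley 0) Gm) p.
Proof.
move=> hG GK; have [B B0 KB] := circle_mx_bound K.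
have [L L0 GL] := circle_mx_lip Gm.
pose M := B * (S%:R + 1) ^+ r.
have S0 : 0 <= S%:R + 1 :> algC by rewrite addr_ge0.
have M0 : 0 <= M by rewrite mulr_ge0 ?exprn_ge0.
have inv s : 0 <= s <= S%:R -> exists2 K' : 'M[algC]_n,
    CE (cayley s) Gm *m K' = 1%:M & forall i j, `|K' i j| <= M.
  (* Here |c| = 2 / |s - i| is at least 1 / (S + 1), so the inverse c^-r K has entries bounded by
     [M]. *)
  move=> /andP[s0 sS]; pose c : algC := circle_eval (cayley s) (1 - tLV).
  have cn : (S%:R + 1)^-1 <= `|c|.
    rewrite /c rmorphB rmorph1 /= circle_eval_tV.
    have -> : 1 - (val (cayley s))^* = (1 - val (cayley s))^* by rewrite rmorphB rmorph1.
    rewrite norm_conjC distrC cayley_dist1.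
    apply: (@le_trans _ _ (`|ratr s - 'i : algC|)^-1).
      rewrite lef_pV2 ?posrE ?normr_gt0 ?cayley_neq0 ?ltr_wpDl ?ltr01 //.
      apply: le_trans (cayley_den_le s0) _; rewrite lerD2r.
      by rewrite -(ratr_nat _ S) ler_rat.
    by rewrite ler_peMl ?invr_ge0 // ler1n.
  have c0 : c != 0.
    by rewrite -normr_gt0 (lt_le_trans _ cn) // invr_gt0 ltr_wpDl ?ltr01.
  exists (c ^- r *: CE (cayley s) K) => [|i j].
    rewrite -scalemxAr -map_mxM GK map_scalar_mx rmorphXn /= -/c scale_scalar_mx.
    by rewrite mulVf ?expf_neq0.
  rewrite [X in `|X| <= _]mxE normrM [leLHS]mulrC ler_pM //.
  rewrite normfV normrX -exprVn lerXn2r ?nnegrE ?invr_ge0 //.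
  by rewrite -[leRHS]invrK lef_pV2 ?posrE ?invr_gt0 ?normr_gt0 ?ltr_wpDl ?ltr01.
(* A step 1/m in the parameter moves the point by at most 2/m and the entries of [Gm] by at most
   2L/m. The condition of [pos_index_perturb] then reads T/m < 1. *)
pose T := n%:R * (L * 2) * (n%:R * M + 1).
have T0 : 0 <= T by apply: mulr_ge0; [do 2?apply: mulr_ge0 | apply: addr_ge0 => //; apply: mulr_ge0].
pose m := (Num.bound T).+1.
have Tm : T < m%:R.
  by apply: lt_trans (archi_boundP T0) _; rewrite ltr_nat.
have m0 : 0 < m%:R :> algC by rewrite ltr0n.
move=> GS.
have : forall j, (j <= S * m)%N -> pos_index_ge (CE (cayley ((S * m - j)%:R / m%:R)) Gm) p.
  elim=> [_|j IHj jS]; first by rewrite subn0 natrM mulfK ?pnatr_eq0.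
  set s := (S * m - j)%:R / m%:R in IHj *; set s' := _ / _.
  have sR : 0 <= s <= S%:R.
    by rewrite divr_ge0 // ler_pdivrMr ?ltr0n // -natrM ler_nat leq_subr.
  have [K' GK' K'M] := inv s sR.
  have ss' : s' = s - m%:R^-1.
    by rewrite /s' /s subnS -subn1 natrB ?subn_gt0 // mulrBl mul1r.
  apply: (@pos_index_perturb _ _ _ K' _ M (L * (2 * m%:R^-1))) (IHj (ltnW jS)) => //.
  - exact: circle_mx_herm.
  - exact: circle_mx_herm.
  - move=> i i'; apply: le_trans (GL _ _ _ _) _; rewrite ler_wpM2l //.
    apply: le_trans (cayley_lip _ _) _; rewrite ler_wpM2l // -rmorphB ss' /=.
    by rewrite addrAC subrr add0r rmorphN normrN fmorphV rmorph_nat normfV normr_nat.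
  - have -> : n%:R * (L * (2 * m%:R^-1)) * (n%:R * M + 1) = T / m%:R by rewrite /T; ring.
    by rewrite ltr_pdivrMr // mul1r.
by move=> /(_ _ (leqnn _)); rewrite subnn mul0r.
Qed.

(** * Inertia near t = 1 *)

Lemma pos_index_conj n (H : 'M[algC]_n) p :
  pos_index_ge H p -> pos_index_ge (map_mx Num.conj H) p.
Proof.
have formC (v : 'rV[algC]_n) : hform (map_mx Num.conj H) (map_mx Num.conj v) = (hform H v)^*.
  rewrite /hform; have -> : ((v *m H *m v^t*) 0 0)^* = map_mx Num.conj (v *m H *m v^t*) 0 0.
    by rewrite [RHS]mxE.
  by rewrite !map_mxM map_trmx.
move=> [U Upos]; exists (map_mx Num.conj U) => u u0.
have -> : u = map_mx Num.conj (map_mx Num.conj u).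
  by apply/matrixP => i j; rewrite !mxE conjCK.
rewrite -map_mxM formC; have /Upos h : map_mx Num.conj u != 0.
  by apply: contraNneq u0 => /matrixP u0; apply/eqP/matrixP => i j; move: (u0 i j);
    rewrite !mxE => /eqP; rewrite conjC_eq0 => /eqP.
by rewrite (CrealP (gtr0_real h)).
Qed.

Local Notation toC := (map_mx (intr : int -> algC)).

Lemma int_mx_adj m n (S : 'M[int]_(m, n)) : (toC S)^t* = toC S^T.
Proof. by apply/matrixP => i j; rewrite !mxE rmorph_int. Qed.

Lemma int_mx_unit n (S : 'M[int]_n) : \det S != 0 -> toC S \in unitmx.
Proof. by move=> dS; rewrite unitmxE det_map_mx unitfE intr_eq0. Qed.

Lemma int_mx_herm n (S : 'M[int]_n) : S^T = S -> toC S \is hermsymmx.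
Proof. by move=> hS; apply/is_hermitianmxP; rewrite expr0 scale1r int_mx_adj hS. Qed.

(* Complex conjugation maps [i J] to [- i J]. *)
Lemma skew_index k (J : 'M[int]_(2 * k)) : J^T = - J -> \det J != 0 ->
  [/\ 'i *: toC J \is hermsymmx, pos_index_ge ('i *: toC J) k &
      pos_index_ge (- ('i *: toC J)) k].
Proof.
move=> JT dJ; set H := 'i *: toC J.
have HH : H \is hermsymmx.
  apply/is_hermitianmxP; rewrite expr0 scale1r /H linearZ /= map_mxZ /= int_mx_adj JT.
  by rewrite conjCi map_mxN scalerN scaleNr opprK.
have HK : H *m (- 'i *: invmx (toC J)) = 1%:M.
  rewrite -scalemxAl -scalemxAr scalerA mulmxV ?int_mx_unit // mulrN -expr2 sqrCi.
  by rewrite opprK scale1r.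
have HC : map_mx Num.conj H = - H.
  rewrite /H map_mxZ /= conjCi scaleNr; congr (- (_ *: _)).
  by apply/matrixP => i j; rewrite !mxE rmorph_int.
have pH := num_posP HH HK; have nH := num_negP HH HK; have pn := num_posneg HH HK.
have := pos_index_conj pH; rewrite HC => pH'.
have := pos_index_conj nH; rewrite map_mxN HC opprK => nH'.
have := pos_index_add pH pH'; have := pos_index_add nH' nH => a b.
by split=> //; [apply: pos_index_mono pH | apply: pos_index_mono nH]; lia.
Qed.

Lemma perturb_mx n (H K : 'M[algC]_n) p : H \is hermsymmx -> H *m K = 1%:M ->
  pos_index_ge H p -> exists2 e, 0 < e & forall H' : 'M_n, H' \is hermsymmx ->
    (forall i j, `|H' i j - H i j| <= e) -> pos_index_ge H' p.
Proof.
move=> HH HK Hp.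
have [||M M0 KM] := @finite_bound ('I_n * 'I_n)%type (fun ij C => `|K ij.1 ij.2| <= C).
- by move=> ij C C' CC' h; apply: le_trans CC'.
- by move=> [i j]; exists `|K i j|.
pose e := (n%:R * (n%:R * M + 1) + 1)^-1.
have T0 : 0 <= n%:R * (n%:R * M + 1) by rewrite mulr_ge0 // addr_ge0 // mulr_ge0.
have e0 : 0 < e by rewrite invr_gt0 ltr_wpDl ?ltr01.
exists e => // H' HH' H'e.
apply: (@pos_index_perturb _ _ H K H' M e) => //; first by move=> i j; apply: (KM (i, j)).
rewrite mulrAC /e ltr_pdivrMr ?ltr_wpDl ?ltr01 // mul1r.
by rewrite ltrDl ltr01.
Qed.

Lemma bound_inv (C e : algC) : 0 <= C -> 0 < e ->
  exists S0 : nat, forall S, (S0 < S)%N -> C / S%:R <= e.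
Proof.
move=> C0 e0; exists (Num.bound (C / e)) => S SS.
have S0 : 0 < S%:R :> algC by rewrite ltr0n (leq_trans _ SS).
rewrite ler_pdivrMr // mulrC -ler_pdivrMr //.
have := archi_boundP (divr_ge0 C0 (ltW e0)) => /ltW h; apply: le_trans h _.
by rewrite ler_nat ltnW.
Qed.

Lemma hermitian_near1 n (A : 'M[Lambda]_n) (K : 'M[algC]_n) p :
  hermitian_mx A -> toC (map_mx Lambda_at1 A) *m K = 1%:M ->
  pos_index_ge (toC (map_mx Lambda_at1 A)) p ->
  exists S0 : nat, forall S, (S0 < S)%N -> pos_index_ge (CE (cayley S%:R) A) p.
Proof.
move=> hA AK Ap.
have A1T : (map_mx Lambda_at1 A)^T = map_mx Lambda_at1 A.
  by rewrite -{2}hA; apply/matrixP => i j; rewrite !mxE Lambda_at1_conj.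
have [e e0 eP] := perturb_mx (int_mx_herm A1T) AK Ap.
have [L L0 AL] := circle_mx_lip A.
have [S0 S0P] := bound_inv (mulr_ge0 (ler0n _ 2) L0) e0.
exists S0 => S SS; apply: eP; first exact: circle_mx_herm.
have n1 : `|1 : algC| == 1 by rewrite normr1.
pose w1 : circle := exist (fun z : algC => is_true (`|z| == 1)) _ n1.
move=> i j; have -> : toC (map_mx Lambda_at1 A) i j = CE w1 A i j.
  by rewrite !mxE circle_eval_at1.
apply: le_trans (AL _ _ _ _) _; apply: le_trans (S0P _ SS).
rewrite cayley_dist1 [2 * L]mulrC -mulrA ler_wpM2l // ler_wpM2l // lef_pV2.
- by rewrite -(ratr_nat _ S) cayley_den_ge.
- by rewrite posrE normr_gt0 cayley_neq0.
- by rewrite posrE ltr0n (leq_trans _ SS).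
Qed.

(** The form vanishes at t = 1, so its leading term decides. At [cayley S] it is a positive multiple
    of i (V - V^T) - (V + V^T) / S, a small perturbation of the form in [skew_index]. *)
Lemma alexander_near1 k (V : 'M[int]_(2 * k)) : seifert_matrix V ->
  exists S0 : nat, forall S, (S0 < S)%N ->
    pos_index_ge (CE (cayley S%:R) (hermitian_alexander V)) k /\
    pos_index_ge (- CE (cayley S%:R) (hermitian_alexander V)) k.
Proof.
move=> hV; set J := V - V^T; set B := V + V^T.
have JT : J^T = - J by rewrite /J linearB /= trmxK opprB.
have dJ : \det J != 0 by rewrite hV.
have [] := skew_index JT dJ; set H := _ *: _ => HH pH nH.
have HK : H *m (- 'i *: invmx (toC J)) = 1%:M.
  rewrite -scalemxAl -scalemxAr scalerA mulmxV ?int_mx_unit // mulrN -expr2 sqrCi.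
  by rewrite opprK scale1r.
have HNK : - H *m ('i *: invmx (toC J)) = 1%:M.
  by rewrite -HK scaleNr mulNmx mulmxN.
have BT : B^T = B by rewrite /B linearD /= trmxK addrC.
have [e e0 eP] := perturb_mx HH HK pH.
have [e' e'0 eP'] := perturb_mx (hermsymN HH) HNK nH.
have [||C C0 BC] := @finite_bound ('I_(2 * k) * 'I_(2 * k))%type
  (fun ij C => `|toC B ij.1 ij.2| <= C).
- by move=> ij C C' CC' h; apply: le_trans CC'.
- by move=> [i j]; exists `|toC B i j|.
have [S0 S0P] := bound_inv C0 e0; have [S0' S0P'] := bound_inv C0 e'0.
exists (maxn S0 S0') => S; rewrite gtn_max => /andP[SS SS'].
have Sgt0 : 0 < S%:R :> algC by rewrite ltr0n (leq_trans _ SS).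
pose d : algC := (S%:R - 'i) * (S%:R + 'i).
have dE : d = S%:R ^+ 2 + 1 by rewrite /d -subr_sqr sqrCi opprK.
have d0 : 0 < d by rewrite dE ltr_wpDl ?ltr01 // exprn_ge0.
have [d1 d2] : S%:R - 'i != 0 :> algC /\ S%:R + 'i != 0 :> algC.
  by apply/andP; rewrite -negb_or -mulf_eq0 gt_eqF.
have NE : CE (cayley S%:R) (hermitian_alexander V) =
    (2 * S%:R / d) *: (H - S%:R^-1 *: toC B).
  apply/matrixP => i j; rewrite !mxE !(rmorphM, rmorphB, rmorph1) /=.
  rewrite circle_eval_tV circle_eval_t -circle_inv cayleyE ratr_nat invf_div.
  rewrite !rmorph_int intrD.
  set v := (V i j)%:~R; set v' := (V j i)%:~R.
  (* With -1 written as i^2, the claim holds for a free variable in place of i. *)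
  have -> : 'i * (v - v') - S%:R^-1 * (v + v') = 'i * (v - v') + 'i ^+ 2 * S%:R^-1 * (v + v') :> algC.
    by rewrite sqrCi; ring.
  by rewrite /d; field; rewrite d1 d2 gt_eqF.
have NH : H - S%:R^-1 *: toC B \is hermsymmx.
  apply: hermsymB HH _; apply/is_hermitianmxP; rewrite expr0 scale1r.
  rewrite linearZ /= map_mxZ /= int_mx_adj BT; congr (_ *: _).
  by rewrite fmorphV rmorph_nat.
have c0 : 0 < 2 * S%:R / d by rewrite divr_gt0 // mulr_gt0.
have diff i j : `|S%:R^-1 * toC B i j| <= C / S%:R.
  by rewrite normrM normfV normr_nat mulrC ler_wpM2r ?invr_ge0 // (BC (i, j)).
rewrite NE -[- (_ *: (H - _))]scalerN; split; apply: (pos_index_scale c0).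
  apply: eP => // i j; apply: le_trans (S0P _ SS); apply: le_trans (diff i j).
  by rewrite !mxE addrAC subrr add0r normrN.
apply: eP' => [|i j]; first exact: hermsymN.
apply: le_trans (S0P' _ SS'); apply: le_trans (diff i j).
by rewrite !mxE opprB addrK.
Qed.

Lemma circle_mx_atN1 m n (B : 'M[Lambda]_(m, n)) :
  CE (cayley 0) B = toC (map_mx Lambda_atN1 B).
Proof. by apply/matrixP => i j; rewrite !mxE circle_eval_atN1 // cayley0. Qed.

(** The positive index found near 1 is carried along the arc to -1 and meets the negative index
    found there. Since p + q is already the full dimension, [pos_index_add] forces both
    contributions of [A] to vanish. *)
Lemma glued_inertia n m (A : 'M[Lambda]_n) (N : 'M[Lambda]_m)
    (Gm K W : 'M[Lambda]_(n + m)) (K1 K2 : 'M[algC]_n) r p q :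
  hermitian_mx A -> hermitian_mx Gm ->
  Lambda_adj W *m Gm *m W = block_mx A 0 0 N -> Gm *m K = ((1 - tLV) ^+ r)%:M ->
  toC (map_mx Lambda_at1 A) *m K1 = 1%:M -> toC (map_mx Lambda_atN1 A) *m K2 = 1%:M ->
  (exists S0 : nat, forall S, (S0 < S)%N -> pos_index_ge (CE (cayley S%:R) N) p) ->
  pos_index_ge (- toC (map_mx Lambda_atN1 N)) q -> (p + q = n + m)%N ->
  num_neg (toC (map_mx Lambda_atN1 A)) = 0 /\ num_pos (toC (map_mx Lambda_at1 A)) = 0.
Proof.
move=> hA hG WGW GK AK1 AK2 [S0 Np] Nq pq.
have A1T : (map_mx Lambda_at1 A)^T = map_mx Lambda_at1 A.
  by rewrite -{2}hA; apply/matrixP => i j; rewrite !mxE Lambda_at1_conj.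
have A1 := num_posP (int_mx_herm A1T) AK1.
have [S1 Ap] := hermitian_near1 hA AK1 A1.
have AN1 : pos_index_ge (- CE (cayley 0) A) (num_neg (toC (map_mx Lambda_atN1 A))).
  by rewrite circle_mx_atN1; apply: num_negP AK2; rewrite -circle_mx_atN1 circle_mx_herm.
have WE w : (CE w W)^t* *m CE w Gm *m (CE w W)^t*^t* = block_mx (CE w A) 0 0 (CE w N).
  by rewrite trmxCK -circle_mx_adj -!map_mxM WGW map_block_mx !map_mx0.
pose S := (maxn S0 S1).+1.
have GS : pos_index_ge (CE (cayley S%:R) Gm) (num_pos (toC (map_mx Lambda_at1 A)) + p).
  apply: (@pos_index_congr _ _ _ ((CE (cayley S%:R) W)^t*)); rewrite WE.
  by apply: pos_index_block; [apply: Ap|apply: Np]; rewrite ltnS leq_max leqnn ?orbT.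
have {}GS := cayley_path hG GK GS.
have G0 : pos_index_ge (- CE (cayley 0) Gm) (num_neg (toC (map_mx Lambda_atN1 A)) + q).
  apply: (@pos_index_congr _ _ _ ((CE (cayley 0) W)^t*)); rewrite mulmxN mulNmx WE.
  rewrite -circle_mx_atN1 in Nq.
  by have := pos_index_block AN1 Nq; rewrite opp_block_mx !oppr0.
have := pos_index_add GS G0; lia.
Qed.

(** * Definiteness and completing the square *)

Lemma num_neg0_posdef n (H K : 'M[algC]_n) : H \is hermsymmx -> H *m K = 1%:M ->
  num_neg H = 0 -> forall v, v != 0 -> 0 < hform H v.
Proof.
move=> HH HK n0 v v0; have := num_posP HH HK; have := num_posneg HH HK.
rewrite n0 addn0 => -> [U Upos].
have uU : U \in unitmx.
  rewrite -row_free_unit -kermx_eq0; apply/eqP/row_matrixP => i; rewrite row0.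
  apply: contraTeq isT => /Upos; rewrite -row_mul mulmx_ker row0 hform0.
  by rewrite ltxx.
rewrite -[v](mulmxKV uU) Upos //; apply: contraNneq v0 => vU.
by rewrite -[v](mulmxKV uU) vU mul0mx.
Qed.

Lemma num_pos0_diag n (H K P : 'M[algC]_n) (d : 'rV[algC]_n) :
  H \is hermsymmx -> H *m K = 1%:M -> num_pos H = 0 ->
  P *m H *m P^t* = diag_mx d -> forall i, ~ 0 < d 0 i.
Proof.
move=> HH HK p0 HP i di; suff : (1 <= num_pos H)%N by rewrite p0.
apply: (pos_index_le_num_pos HH HK); apply: (@pos_index_congr _ _ _ P); rewrite HP.
exists (delta_mx 0 i) => u u0; rewrite hform_diag (bigD1 i) //= big1 => [|j /negPf ji].
  rewrite addr0 mulr_gt0 // exprn_gt0 // normr_gt0.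
  apply: contraNneq u0; rewrite mxE big_ord1 !mxE !eqxx mulr1 => u0.
  by apply/eqP/rowP => j; rewrite ord1 u0 mxE.
by rewrite mxE big_ord1 !mxE ji andbF mulr0 normr0 expr0n mulr0.
Qed.

Section Definite.
Variable F : fieldType.

Lemma schur_form n (a : F) (b : 'rV[F]_n) (C : 'M[F]_n) (x0 : 'M[F]_1) (x : 'cV[F]_n) :
  a != 0 ->
  (col_mx x0 x)^T *m block_mx a%:M b b^T C *m col_mx x0 x =
  a *: ((x0 + a^-1 *: (b *m x))^T *m (x0 + a^-1 *: (b *m x)))
  + x^T *m (C - a^-1 *: (b^T *m b)) *m x.
Proof.
move=> a0; rewrite tr_col_mx mul_row_block mul_row_col.
have -> : (x0 + a^-1 *: (b *m x))^T = x0^T + a^-1 *: (x^T *m b^T).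
  by rewrite linearD linearZ /= trmx_mul.
have -> : a *: ((x0^T + a^-1 *: (x^T *m b^T)) *m (x0 + a^-1 *: (b *m x))) =
    (x0^T *m a%:M + x^T *m b^T) *m x0 + x0^T *m b *m x + a^-1 *: (x^T *m b^T *m (b *m x)).
  rewrite mul_mx_scalar !mulmxDl !mulmxDr -!scalemxAl -!scalemxAr !scalerDr !scalerA.
  by rewrite !mulfV // mul1r !scale1r !mulmxA; set u := a *: _; rewrite !addrA (addrAC u).
rewrite mulmxBr mulmxBl -scalemxAr -scalemxAl !mulmxDl !mulmxA -!addrA.
by congr (_ + (_ + (_ + _))); rewrite addrC subrK.
Qed.
End Definite.

(* Completing the square only involves rational coefficients. *)
Lemma rat_posdef_transfer n (A : 'M[rat]_n) : A^T = A ->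
  (forall x : 'cV[rat]_n, x != 0 -> 0 < (x^T *m A *m x) 0 0) ->
  forall (R : realFieldType) (x : 'cV[R]_n), x != 0 -> 0 < (x^T *m map_mx ratr A *m x) 0 0.
Proof.
elim: n A => [|n IHn] A AT Apos R x x0.
  by case/eqP: x0; apply/matrixP => -[].
move: A AT Apos x x0; rewrite -[n.+1]/(1 + n)%N => A AT Apos x x0.
pose a := A 0 0; pose b : 'rV_n := ursubmx A; pose C := drsubmx A.
have AE : A = block_mx a%:M b b^T C.
  rewrite -[A]submxK; congr block_mx; last by rewrite /b trmx_ursub AT.
  by rewrite [LHS]mx11_scalar; congr (_%:M); rewrite !mxE; congr (A _ _); apply: val_inj.
have CT : C^T = C by rewrite /C trmx_drsub AT.
have a_gt0 : 0 < a.
  have := Apos (delta_mx 0 0); rewrite trmx_delta -rowE -colE !mxE; apply.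
  by apply/eqP => /matrixP/(_ 0 0); rewrite !mxE.
have an0 : a != 0 by rewrite gt_eqF.
pose S := C - a^-1 *: (b^T *m b).
have ST : S^T = S by rewrite /S linearB linearZ /= trmx_mul trmxK CT.
have Spos (y : 'cV[rat]_n) : y != 0 -> 0 < (y^T *m S *m y) 0 0.
  (* This vector kills the completed square and leaves the Schur complement. *)
  move=> y0; have := Apos (col_mx (- (a^-1 *: (b *m y))) y).
  rewrite AE schur_form // addNr mulmx0 scaler0 add0r; apply.
  by apply: contraNneq y0 => /eqP; rewrite col_mx_eq0 => /andP[].
have {}IHn := IHn S ST Spos R.
have arn0 : ratr a != 0 :> R by rewrite fmorph_eq0.
rewrite AE map_block_mx map_scalar_mx -map_trmx -[x]vsubmxK schur_form //.
have -> : map_mx ratr C - (ratr a)^-1 *: ((map_mx ratr b)^T *m map_mx ratr b) = map_mx ratr S :> 'M[R]_n.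
  by rewrite /S map_mxB map_mxZ map_mxM map_trmx fmorphV.
set y := usubmx x + _; rewrite mxE.
have -> : (ratr a *: (y^T *m y)) 0 0 = ratr a * y 0 0 ^+ 2 by rewrite !mxE big_ord1 !mxE expr2.
have ar0 : 0 < ratr a :> R by rewrite ltr0q.
have [d0|d0] := eqVneq (dsubmx x) 0.
  rewrite d0 mulmx0 [X in _ + X]mxE addr0 mulr_gt0 // exprn_even_gt0 //=.
  apply: contraNneq x0 => y0; rewrite -[x]vsubmxK d0 (_ : usubmx x = 0) ?col_mx0 //.
  have -> : usubmx x = y by rewrite /y d0 mulmx0 scaler0 addr0.
  by apply/matrixP => i j; rewrite !ord1 y0 mxE.
by rewrite ltr_wpDl ?IHn // mulr_ge0 ?sqr_ge0 // ltW.
Qed.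

(** * Evaluation at -1 *)

Lemma quot_field_piD (R : comNzRingType) (F : fieldType) (iota : {rmorphism R -> F}) (x y : F) :
  \pi_(quot_field iota) (x + y) = \pi_(quot_field iota) x + \pi_(quot_field iota) y.
Proof. exact: (@Quotient.pi_add _ (integral iota)). Qed.

(** Division of the last identity by [A] gives 2 F^T B^-1 F = A^-1 + X, and [X] disappears modulo
    integers. *)
Lemma linking_isometry n m (A : 'M[int]_n) (B : 'M[int]_m) F G F' G' Y Z X :
  A^T = A -> \det A != 0 -> B^T = B -> \det B != 0 ->
  F *m A = B *m G -> F' *m B = A *m G' ->
  F' *m F = 1%:M + A *m Y -> F *m F' = 1%:M + B *m Z ->
  2 *: (F^T *m G) = 1%:M + X *m A ->
  isometric (linking_mx (A := A)) (fun v w => linking_mx (A := B) v w *+ 2).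
Proof.
move=> AT dA BT dB FA F'B F'F FF' XA.
have [f fbij fE] := coker_iso_of_matrices FA F'B F'F FF'.
exists f; split=> // x y; rewrite -[x]coker_pi_repr -[y]coker_pi_repr !fE /coker_pi.
rewrite !linking_mx_pi // mulr2n -quot_field_piD.
apply/quot_field_eq.
move: (repr x) (repr y) => a b.
pose Q m n := map_mx (intr : int -> rat) : 'M_(m, n) -> 'M_(m, n).
have uA : Q _ _ A \in unitmx by rewrite unitmxE det_map_mx unitfE intr_eq0.
have uB : Q _ _ B \in unitmx by rewrite unitmxE det_map_mx unitfE intr_eq0.
have XE : 2 *: ((Q _ _ F)^T *m invmx (Q _ _ B) *m Q _ _ F) = invmx (Q _ _ A) + Q _ _ X.
  apply: (can_inj (mulmxK uA)).
  have FA' : Q _ _ F *m Q _ _ A = Q _ _ B *m Q _ _ G by rewrite /Q -!map_mxM FA.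
  have XA' : 2 *: ((Q _ _ F)^T *m Q _ _ G) = 1%:M + Q _ _ X *m Q _ _ A.
    have := congr1 (Q n n) XA; rewrite /Q map_mxZ map_mxD map_mx1 !map_mxM -map_trmx.
    by rewrite rmorph_nat.
  rewrite mulmxDl mulVmx // -XA' -scalemxAl -!mulmxA FA'.
  by rewrite (mulmxA (invmx _)) mulVmx // mul1mx.
exists ((a^T *m X *m b) 0 0).
transitivity (((Q _ _ a)^T *m Q _ _ X *m Q _ _ b) 0 0); last first.
  by rewrite /Q map_trmx -!map_mxM [LHS]mxE.
have -> : Q _ _ X = 2 *: ((Q _ _ F)^T *m invmx (Q _ _ B) *m Q _ _ F) - invmx (Q _ _ A).
  by rewrite XE addrC addKr.
rewrite mulmxBr mulmxBl [RHS]mxE [X in _ = _ + X]mxE !map_mxM !trmx_mul.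
congr (_ - _).
by rewrite -scalemxAr -scalemxAl [RHS]mxE [RHS]mulr_natl -mulr2n !mulmxA.
Qed.

Lemma alexander_atN1 k (V : 'M[int]_(2 * k)) :
  map_mx Lambda_atN1 (alexander_mx V) = - (V + V^T).
Proof.
apply/matrixP => i j; rewrite !mxE rmorphB rmorphM /= Lambda_atN1_t !rmorph_int !intz.
by ring.
Qed.

Lemma hermitian_alexander_atN1 k (V : 'M[int]_(2 * k)) :
  map_mx Lambda_atN1 (hermitian_alexander V) = - (2 *: (V + V^T)).
Proof.
rewrite /hermitian_alexander map_mxZ alexander_atN1 scalerN rmorphB rmorph1 /=.
by rewrite -Lambda_conj_t Lambda_atN1_conj Lambda_atN1_t.
Qed.

(** The determinant is odd: it is the value at -1 of [\det (alexander_mx V)], whose value at 1 is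
    1. *)
Lemma symmetrized_seifert_det k (V : 'M[int]_(2 * k)) :
  seifert_matrix V -> \det (V + V^T) != 0.
Proof.
move=> hV; have [c] := Lambda_at_mod2 (\det (alexander_mx V)).
rewrite -!det_map_mx alexander_atN1.
have -> : map_mx Lambda_at1 (alexander_mx V) = V - V^T.
  apply/matrixP => i j; rewrite !mxE rmorphB rmorphM /= Lambda_at1_t mul1r.
  by rewrite !rmorph_int !intz.
rewrite hV -scaleN1r detZ => E; apply: contra_eqN E => /eqP->.
by rewrite mulr0; lia.
Qed.

(** The two indices add up to 2k and differ by 2n, so the larger one is k + n. *)
Lemma knot_signature_index k (V : 'M[int]_(2 * k)) n (eps : int) :
  seifert_matrix V -> eps = 1 \/ eps = -1 -> knot_signature V = 2 * n%:Z * eps ->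
  pos_index_ge (map_mx (intr : int -> algC) (eps *: (V + V^T))) (k + n).
Proof.
move=> hV he; set B := V + V^T; pose H := map_mx (intr : int -> algC) B.
rewrite /knot_signature /signature -/B -/H -/(num_pos H) -/(num_neg H) => sE.
have BT : B^T = B by rewrite /B linearD /= trmxK addrC.
have HH : H \is hermsymmx := int_mx_herm BT.
have HK : H *m invmx H = 1%:M by rewrite mulmxV // int_mx_unit // symmetrized_seifert_det.
have pn := num_posneg HH HK.
case: he sE => -> sE.
  rewrite scale1r -/H; apply: pos_index_mono (num_posP HH HK); lia.
rewrite scaleN1r map_mxN -/H; apply: pos_index_mono (num_negP HH HK); lia.
Qed.

Section Evaluation.
Variables (k n : nat) (V : 'M[int]_(2 * k)) (A : 'M[Lambda]_n).
Variables (P : 'M[int]_n) (d : 'rV[int]_n).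
Hypotheses (hV : seifert_matrix V) (hA : hermitian_mx A) (dA : \det A != 0).
Hypothesis isoA : isometric (lambda_mx (A := A)) (blanchfield (V := V)).
Hypotheses (uP : P \in unitmx) (d1 : forall i, d 0 i = 1 \/ d 0 i = -1).
Hypothesis PA1 : P^T *m map_mx Lambda_at1 A *m P = diag_mx d.

Let B := V + V^T.
Let A' := P^T *m map_mx Lambda_atN1 A *m P.

Let BT : B^T = B. Proof. by rewrite /B linearD /= trmxK addrC. Qed.
Let dB : \det B != 0. Proof. exact: symmetrized_seifert_det. Qed.

Let A_atN1T : (map_mx Lambda_atN1 A)^T = map_mx Lambda_atN1 A.
Proof. by rewrite -{2}hA; apply/matrixP => i j; rewrite !mxE Lambda_atN1_conj. Qed.

Let A_at1T : (map_mx Lambda_at1 A)^T = map_mx Lambda_at1 A.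
Proof. by rewrite -{2}hA; apply/matrixP => i j; rewrite !mxE Lambda_at1_conj. Qed.

Lemma evaluationT : A'^T = A'.
Proof. by rewrite /A' !trmx_mul trmxK A_atN1T mulmxA. Qed.

(** The base change is made over [Lambda], before evaluation, so that values at 1 and -1 can be
    compared entry by entry. *)
Let PL := map_mx (intr : int -> Lambda) P.
Let A1 := PL^T *m A *m PL.

Let A1_at1 : map_mx Lambda_at1 A1 = diag_mx d.
Proof.
rewrite /A1 !map_mxM -map_trmx -PA1 /PL; congr (_^T *m _ *m _); apply/matrixP => i j;
by rewrite !mxE rmorph_int intz.
Qed.

Let A1_atN1 : map_mx Lambda_atN1 A1 = A'.
Proof.
rewrite /A1 !map_mxM -map_trmx /A' /PL; congr (_^T *m _ *m _); apply/matrixP => i j;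
by rewrite !mxE rmorph_int intz.
Qed.

Lemma evaluation_mod2 i j : (A' i j = (1%:M : 'M[int]_n) i j %[mod 2])%Z.
Proof.
have [c] := Lambda_at_mod2 (A1 i j).
have -> : Lambda_atN1 (A1 i j) = A' i j by rewrite -A1_atN1 [RHS]mxE.
have -> : Lambda_at1 (A1 i j) = diag_mx d i j by rewrite -A1_at1 [RHS]mxE.
move=> ->; apply/eqP; rewrite eqz_mod_dvd !mxE.
case: eqP => [_|_]; last by rewrite !mulr0n subr0 add0r dvdz_mulr.
rewrite !mulr1n; case: (d1 i) => ->.
  by rewrite addrAC subrr add0r dvdz_mulr.
by rewrite (_ : -1 + 2 * c - 1 = 2 * (c - 1)) ?dvdz_mulr //; ring.
Qed.

(** Diagonal entries of the hermitian matrix [A1] are fixed by the involution, as [Lambda_at_mod4]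
    requires. *)
Lemma evaluation_diag_mod4 i : (A' i i = d 0%R i %[mod 4])%Z.
Proof.
have hA1 : Lambda_conj (A1 i i) = A1 i i.
  have PLJ : map_mx Lambda_conj PL = PL.
    by apply/matrixP => a b; rewrite !mxE rmorph_int.
  have : (map_mx Lambda_conj A1)^T = A1.
    by rewrite /A1 !map_mxM -map_trmx PLJ !trmx_mul trmxK hA mulmxA.
  by move/matrixP/(_ i i); rewrite !mxE.
have [c] := Lambda_at_mod4 hA1.
have -> : Lambda_atN1 (A1 i i) = A' i i by rewrite -A1_atN1 [RHS]mxE.
have -> : Lambda_at1 (A1 i i) = diag_mx d i i by rewrite -A1_at1 [RHS]mxE.
move=> ->; apply/eqP; rewrite eqz_mod_dvd mxE eqxx mulr1n.
by rewrite addrAC subrr add0r dvdz_mulr.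
Qed.

Lemma evaluation_linking : `|\det A'| = `|\det B| /\
  isometric (linking_mx (A := A')) (fun v w => linking_mx (A := B) v w *+ 2).
Proof.
have [F [F' [G [G' [Y [Z [X]]]]]]] := blanchfield_matrices hV hA dA isoA.
case=> FA F'D F'F FF' XA; pose Q := invmx P.
have PQ : P *m Q = 1%:M := mulmxV uP.
have QP : Q *m P = 1%:M := mulVmx uP.
have PQT : P^T *m Q^T = 1%:M by rewrite -trmx_mul QP trmx1.
have QPT : Q^T *m P^T = 1%:M by rewrite -trmx_mul PQ trmx1.
pose e m n (M : 'M[Lambda]_(m, n)) : 'M[int]_(m, n) := map_mx Lambda_atN1 M.
have eM m p q (M : 'M_(m, p)) (N : 'M_(p, q)) : e _ _ (M *m N) = e _ _ M *m e _ _ N.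
  exact: map_mxM.
have e1D p (M : 'M_p) : e _ _ (1%:M + M) = 1%:M + e _ _ M by rewrite /e map_mxD map_mx1.
have eZ m p c (M : 'M_(m, p)) : e _ _ (c *: M) = Lambda_atN1 c *: e _ _ M by exact: map_mxZ.
have eD : e _ _ (alexander_mx V) = - B := alexander_atN1 V.
have eF : e _ _ (Lambda_adj F) = (e _ _ F)^T.
  by apply/matrixP => i j; rewrite !mxE Lambda_atN1_conj.
move: (congr1 (e _ _) FA) (congr1 (e _ _) F'D) (congr1 (e _ _) F'F) (congr1 (e _ _) FF').
rewrite !e1D !eM eD => {}FA {}F'D {}F'F {}FF'.
have {}XA : - (2 *: ((e _ _ F)^T *m e _ _ G)) = 1%:M + e _ _ X *m e _ _ A.
  have := congr1 (e _ _) XA; rewrite e1D !eM eZ eM eF => <-.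
  by rewrite rmorphB rmorph1 /= Lambda_atN1_t -scaleNr.
set a := e _ _ A in FA F'D F'F XA.
have A'E : A' = P^T *m a *m P by [].
(* [P^T] maps the cokernel of [a] onto that of [A'], hence the factor [Q^T]. The minus signs absorb
   that [alexander_mx V] becomes -B and t - 1 becomes -2. *)
pose F1 := e _ _ F *m Q^T; pose F1' := P^T *m e _ _ F'.
pose G1 := - (e _ _ G *m P); pose G1' := - (Q *m e _ _ G').
pose Y1 := Q *m e _ _ Y *m Q^T; pose Z1 := - e _ _ Z; pose X1 := Q *m e _ _ X *m Q^T.
have FA1 : F1 *m A' = B *m G1.
  rewrite /F1 A'E !mulmxA -[_ *m Q^T *m P^T]mulmxA QPT mulmx1 FA /G1.
  by rewrite mulmxN mulNmx mulNmx mulmxA.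
have F'B1 : F1' *m B = A' *m G1'.
  rewrite /F1' A'E /G1' mulmxN -!mulmxA (mulmxA P) PQ mul1mx -F'D.
  by rewrite mulmxN mulmxN opprK.
have F'F1 : F1' *m F1 = 1%:M + A' *m Y1.
  rewrite /F1' /F1 A'E /Y1 -!mulmxA (mulmxA (e _ _ F')) F'F (mulmxA P Q) PQ mul1mx.
  by rewrite mulmxDl mul1mx mulmxDr PQT -!mulmxA.
have FF1 : F1 *m F1' = 1%:M + B *m Z1.
  rewrite /F1 /F1' -!mulmxA (mulmxA Q^T) QPT mul1mx FF' /Z1.
  by rewrite mulmxN mulNmx.
have XA1 : 2 *: (F1^T *m G1) = 1%:M + X1 *m A'.
  rewrite /F1 /G1 /X1 A'E trmx_mul trmxK mulmxN -!mulmxA (mulmxA Q^T) QPT mul1mx.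
  have -> : 2 *: - (Q *m ((e _ _ F)^T *m (e _ _ G *m P))) =
     Q *m (- (2 *: ((e _ _ F)^T *m e _ _ G))) *m P.
    by rewrite mulmxN mulNmx -scalemxAr -scalemxAl scalerN !mulmxA.
  by rewrite XA mulmxDr mulmxDl mulmx1 QP !mulmxA.
have [u [u' [uE u'E]]] := det_dvd_coker FA1 F'B1 F'F1 FF1.
have uu' : u * u' = 1.
  by apply: (mulfI dB); rewrite mulrA -uE -u'E mulr1.
have dA' : \det A' != 0.
  by apply: contra_neq dB => dA'; rewrite u'E dA' mul0r.
have dE : `|\det A'| = `|\det B|.
  have : `|u| = 1.
    have /eqP := congr1 absz uu'; rewrite abszM muln_eq1 => /andP[/eqP u1 _].
    by rewrite -abszE u1.
  by rewrite uE normrM => ->; rewrite mulr1.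
split=> //; apply: linking_isometry FA1 F'B1 F'F1 FF1 XA1 => //.
exact: evaluationT.
Qed.

Lemma evaluation_definite (eps : int) : eps = 1 \/ eps = -1 ->
  knot_signature V = 2 * n%:Z * eps ->
  definite eps A' /\ (forall i, d 0 i = - eps).
Proof.
move=> he sE.
have [Gm [K [W [hG WGW GK]]]] := glued_form hV hA dA isoA.
(* Scaling by eps treats both signs at once: near 1 the Seifert form has index k for either sign,
   and at -1 the negative of its scaled form is 2 eps (V + V^T), of index k + n. *)
pose eL : Lambda := eps%:~R.
have eLC : Lambda_conj eL = eL by rewrite /eL rmorph_int.
have eLL : eL * eL = 1 by rewrite /eL -intrM; case: he => ->.
have hZ m (M : 'M[Lambda]_m) : hermitian_mx M -> hermitian_mx (eL *: M).
  by move=> hM; rewrite /hermitian_mx -/(Lambda_adj _) Lambda_adjZ eLC /Lambda_adj hM.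
have e0 : eps != 0 by case: he => ->.
have dP : \det P != 0 by apply: contraTneq uP => dP0; rewrite unitmxE dP0 unitr0.
have dA1 : \det (map_mx Lambda_at1 A) != 0.
  have : \det (diag_mx d) != 0.
    rewrite det_diag; apply/prodf_neq0 => i _; by case: (d1 i) => ->.
  by rewrite -PA1 !det_mulmx !mulf_eq0 !negb_or => /andP[/andP[_ ->]].
have dAN1 : \det (map_mx Lambda_atN1 A) != 0.
  have [E _] := evaluation_linking.
  have : `|\det A'| != 0 by rewrite E normr_eq0.
  by rewrite normr_eq0 /A' !det_mulmx !mulf_eq0 !negb_or => /andP[/andP[_ ->]].
have atE : map_mx Lambda_at1 (eL *: A) = eps *: map_mx Lambda_at1 A.
  by rewrite map_mxZ /= rmorph_int intz.
have atNE m p (M : 'M_(m, p)) : map_mx Lambda_atN1 (eL *: M) = eps *: map_mx Lambda_atN1 M.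
  by rewrite map_mxZ /= rmorph_int intz.
have dZ m (M : 'M[int]_m) : \det M != 0 -> \det (eps *: M) != 0.
  by move=> dM; rewrite detZ mulf_neq0 // expf_neq0.
have A1K := mulmxV (int_mx_unit (dZ _ _ dA1)); rewrite -atE in A1K.
have ANK := mulmxV (int_mx_unit (dZ _ _ dAN1)); rewrite -atNE in ANK.
have [] := @glued_inertia _ _ (eL *: A) (eL *: hermitian_alexander V) (eL *: Gm) (eL *: K) W
  _ _ (2 * k) k (k + n) (hZ _ _ hA) (hZ _ _ hG) _ _ A1K ANK.
- by rewrite -scalemxAr -scalemxAl WGW scale_block_mx !scaler0.
- by rewrite -scalemxAl -scalemxAr scalerA eLL scale1r.
- have [S0 S0P] := alexander_near1 hV; exists S0 => S /S0P[pos neg].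
  have -> : map_mx (circle_eval (cayley S%:R)) (eL *: hermitian_alexander V) =
      eps%:~R *: map_mx (circle_eval (cayley S%:R)) (hermitian_alexander V).
    by rewrite map_mxZ /= rmorph_int.
  by case: he => ->; rewrite ?mulrN1z ?scaleN1r ?scale1r.
- rewrite atNE hermitian_alexander_atN1 -map_mxN scalerN opprK scalerA mulrC -scalerA.
  rewrite map_mxZ; apply: pos_index_scale; first by rewrite ltr0z.
  exact: knot_signature_index.
- by lia.
move=> neg0 pos0; split.
  (* Positivity over [algC], restricted to rational vectors, is what [rat_posdef_transfer] carries
     to every ordered field. *)
  move=> R x x0; pose M := eps *: map_mx Lambda_atN1 A.
  have MT : M^T = M by rewrite /M linearZ /= A_atN1T.
  rewrite atNE -/M in neg0 ANK.
  have Mpos := num_neg0_posdef (int_mx_herm MT) ANK neg0.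
  have MP : P^T *m M *m P = eps *: A' by rewrite /M -scalemxAr -scalemxAl.
  have <- : (x^T *m map_mx ratr (map_mx intr (eps *: A') : 'M[rat]_n) *m x) 0 0 =
      eps%:~R * (x^T *m map_mx intr A' *m x) 0 0.
    rewrite -map_mx_comp (eq_map_mx _ (fun c : int => ratr_int R c)) map_mxZ.
    by rewrite -scalemxAr -scalemxAl [LHS]mxE.
  apply: rat_posdef_transfer x0; first by rewrite map_trmx linearZ /= evaluationT.
  move=> y y0; pose v : 'rV[algC]_n := map_mx ratr y^T *m map_mx intr P^T.
  have v0 : v != 0.
    have uPC : map_mx (intr : int -> algC) P^T \in unitmx.
      by apply: int_mx_unit; rewrite det_tr.
    apply: contraNneq y0 => vE; apply/eqP; rewrite -[y]trmxK.
    have : map_mx ratr y^T = 0 :> 'rV[algC]_n by rewrite -[LHS](mulmxK uPC) -/v vE mul0mx.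
    by move/eqP; rewrite map_mx_eq0 => /eqP->; rewrite trmx0.
  rewrite -(ltr0q algC); have := Mpos v v0; rewrite /hform.
  have -> : (map_mx Num.conj v^T) = map_mx intr P *m map_mx ratr y.
    rewrite /v trmx_mul !map_trmx !trmxK map_mxM -!map_mx_comp.
    by congr (_ *m _); apply/matrixP => a b; rewrite !mxE /= ?rmorph_int ?fmorph_rat.
  have -> : v *m map_mx intr M *m (map_mx intr P *m map_mx ratr y) =
      map_mx ratr (y^T *m map_mx intr (eps *: A') *m y).
    rewrite -MP !map_mxM -!map_mx_comp /v !mulmxA.
    have E a b (N : 'M[int]_(a, b)) : map_mx (ratr \o intr) N = map_mx intr N :> 'M[algC]_(a, b).
      by apply: eq_map_mx => c /=; rewrite ratr_int.
    by rewrite !E.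
  by rewrite [X in 0 < X -> _]mxE.
move=> i.
have A1T : (map_mx Lambda_at1 (eL *: A))^T = map_mx Lambda_at1 (eL *: A).
  by rewrite atE linearZ /= A_at1T.
have := @num_pos0_diag _ _ _ (map_mx intr P^T) (map_mx intr (eps *: d)) (int_mx_herm A1T) A1K pos0 _ i.
rewrite int_mx_adj trmxK -!map_mxM atE -scalemxAr -scalemxAl PA1 -map_diag_mx linearZ.
rewrite !mxE ltr0z => /(_ erefl).
by case: he => ->; case: (d1 i) => -> //; rewrite ?mul1r ?mulrNN ?mulr1.
Qed.
End Evaluation.

Local Close Scope sesquilinear_scope.
Local Close Scope quotient_scope.
Unset Implicit Arguments.

Theorem theorem3p4 (k : nat) (V : 'M[int]_(2 * k)) (n : nat) :
  seifert_matrix V -> knot_n_is V n ->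
  let props123 (A : 'M[int]_n) :=
    [/\ A^T = A,
        `|\det A| = `|knot_det V|,
        isometric (linking_mx (A := A))
          (fun v w => knot_linking (V := V) v w *+ 2) &
        forall i j, (A i j = (1%:M : 'M[int]_n) i j %[mod 2])%Z] in
  (exists A : 'M[int]_n, props123 A) /\
  (forall eps : int, eps = 1 \/ eps = -1 ->
     knot_signature V = 2 * n%:Z * eps ->
     exists A : 'M[int]_n,
       [/\ props123 A, definite eps A & forall i, (A i i = - eps %[mod 4])%Z]).
Proof.
move=> hV [[A [hA dA isoA [P [d [uP d1 PA1]]]]] _] props123.
have props : props123 (P^T *m map_mx Lambda_atN1 A *m P).
  have [dE iso] := evaluation_linking hV hA dA isoA uP.
  split=> //; first exact: evaluationT.
    by rewrite dE /knot_det normrM normrX normrN1 expr1n mul1r.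
  exact: evaluation_mod2 d1 PA1.
split; first by exists (P^T *m map_mx Lambda_atN1 A *m P).
move=> eps he sE; exists (P^T *m map_mx Lambda_atN1 A *m P).
have [def dE] := evaluation_definite hV hA dA isoA uP d1 PA1 he sE.
by split=> // i; rewrite -(dE i); apply: evaluation_diag_mod4 hA PA1 i.
Qed.
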